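(* Let $\alpha$ be a partition with all parts $\ge 2$ and overlapping partition $p=(p_1,\dots,p_{\ell(\alpha)-1},0)$, and for $1\le i\le \ell(p)-1$ let $\varrho_i=1+\sum_{q=i+1}^{\ell(\alpha)}\alpha_q-p_{i+1}$. Then $[R_\alpha^p]=[\alpha,(|\alpha|-p_1,p_1)]$ if and only if either $\ell(p)<2$, or $\ell(p)\ge2$ and $$\sum_{j=1}^i[\varrho_i-\alpha_j]_+\ge p_{i+1}\quad\text{for every } 1\le i\le \ell(p)-1.$$
   Context: A partition $\alpha=(\alpha_1\ge\dots\ge\alpha_{\ell(\alpha)}>0)$ has length $\ell(\alpha)$ and size $|\alpha|$. A ribbon is a skew Young diagram (English convention) containing no $2\times2$ square. For a partition $\alpha$ with all parts $\ge2$, a ribbon $R_\alpha$ has rows, from top to bottom, of lengths $\alpha_1,\dots,\alpha_{\ell(\alpha)}$, consecutive rows sharing at most one column and non-consecutive rows sharing none. Its overlapping partition is $p=(p_1,\dots,p_{\ell(\alpha)-1},0)$ where $p_i$ is the number of columns of length two in the last $\ell(\alpha)-i+1$ rows; $\ell(p)$ is the number of nonzero parts of $p$. The ribbon is determined by $(\alpha,p)$ and denoted $R_\alpha^p$. For a skew shape $A$, $s_A=\sum_\nu c_A^\nu s_\nu$ and the Schur support is $[A]=\{\nu:c_A^\nu>0\}$. $\preceq$ is dominance order and $[\lambda,\mu]=\{\nu:\lambda\preceq\nu\preceq\mu\}$. For real $x$, $[x]_+=\max\{0,x\}$. *)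

(* Defs.v *)
From mathcomp Require Import all_boot all_order all_algebra.
From mathcomp Require Import mpoly.

Set Implicit Arguments.
Unset Strict Implicit.
Unset Printing Implicit Defensive.

Import Order.TTheory GRing.Theory Num.Theory.

Local Open Scope nat_scope.

Definition is_partition (s : seq nat) : bool := sorted geq s && (0 \notin s).

(* The entry with 1-based index [i], and 0 beyond the last entry; only used
   with [1 <= i]. *)
Definition part (s : seq nat) (i : nat) : nat := nth 0 s i.-1.

Definition num_nonzero (s : seq nat) : nat := count (fun x => 0 < x) s.

(* All partitions of [k]: they have at most [k] parts, each at most [k]. *)
Definition partitions (k : nat) : seq (seq nat) :=
  [seq s <- [seq map val t | t : k.-bseq 'I_k.+1 <- enum {: k.-bseq 'I_k.+1}]
     | is_partition s && (sumn s == k)].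

Lemma partitions_uniq k : uniq (partitions k).
Proof.
rewrite filter_uniq // map_inj_uniq ?enum_uniq // => s t /= eq_st.
by apply: val_inj; apply: (inj_map val_inj).
Qed.

Lemma mem_partitions k s :
  (s \in partitions k) = is_partition s && (sumn s == k).
Proof.
rewrite mem_filter andb_idr // => /andP[/andP[_ s_pos] /eqP sum_s].
have le_part x : x \in s -> x <= k.
  by rewrite -sum_s => xs; rewrite (perm_sumn (perm_to_rem xs)) leq_addr.
have le_size : size s <= k.
  rewrite -sum_s; elim: s s_pos {sum_s le_part} => //= x s IHs.
  by rewrite inE negb_or eq_sym -lt0n => /andP[x0 /IHs]; rewrite -add1n; apply: leq_add.
have size_t : size [seq inord x : 'I_k.+1 | x <- s] <= k by rewrite size_map.
apply/mapP; exists (Bseq size_t); first by rewrite mem_enum.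
rewrite /= -map_comp -[LHS]map_id; apply/eq_in_map => x xs /=.
by rewrite inordK // ltnS le_part.
Qed.

Definition dominated (lam nu : seq nat) : Prop :=
  sumn lam = sumn nu /\
  forall k : nat, sumn (take k lam) <= sumn (take k nu).

(* Trailing zeros in [lam] or [mu] do not affect the interval. *)
Definition in_dominance_interval (lam mu nu : seq nat) : Prop :=
  [/\ is_partition nu, dominated lam nu & dominated nu mu].

Definition is_skew_shape (lam mu : seq nat) : Prop :=
  [/\ is_partition lam, is_partition mu &
      forall i, 1 <= i -> part mu i <= part lam i].

(* The cells (row, column) of lam / mu, numbered from 1, in the English
   convention. *)
Definition diagram (lam mu : seq nat) : seq (nat * nat) :=
  [seq (i, j) | i <- iota 1 (size lam),
                j <- iota (part mu i).+1 (part lam i - part mu i)].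

Definition is_ssyt (D : seq (nat * nat)) (n : nat)
    (T : {ffun seq_sub D -> 'I_n}) : bool :=
  [forall x, forall y,
     (((val x).1 == (val y).1) && ((val x).2 < (val y).2) ==> (T x <= T y)) &&
     (((val x).2 == (val y).2) && ((val x).1 < (val y).1) ==> (T x < T y))].

Definition skew_schur (n : nat) (lam mu : seq nat) : {mpoly int[n]} :=
  (\sum_(T : {ffun seq_sub (diagram lam mu) -> 'I_n} | is_ssyt T)
     \prod_x 'X_(T x))%R.

Definition schur (n : nat) (nu : seq nat) : {mpoly int[n]} :=
  skew_schur n nu [::].

(* [c nu] is the coefficient of s_nu in s_{lam / mu}. An identity between
   symmetric functions is one that holds in every finite number of variables;
   as s_{lam / mu} is homogeneous, only the partitions of |lam / mu| occur. *)
Definition is_schur_expansion (lam mu : seq nat) (c : seq nat -> int) : Prop :=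
  let k := size (diagram lam mu) in
  (forall n : nat,
     skew_schur n lam mu = \sum_(nu <- partitions k) c nu *: schur n nu)%R /\
  (forall nu, nu \notin partitions k -> c nu = 0%R).

(* The Schur functions form a basis, so the expansion exists and is unique. *)
Definition in_schur_support (lam mu nu : seq nat) : Prop :=
  exists c : seq nat -> int, is_schur_expansion lam mu c /\ (0 < c nu)%R.

Definition no_2x2_square (D : seq (nat * nat)) : Prop :=
  forall i j, ~ [/\ (i, j) \in D, (i, j.+1) \in D,
                    (i.+1, j) \in D & (i.+1, j.+1) \in D].

Definition shared_columns (lam mu : seq nat) (r s : nat) : nat :=
  count (fun j => ((r, j) \in diagram lam mu) && ((s, j) \in diagram lam mu))
        (iota 1 (part lam 1)).

(* lam / mu is a ribbon with row lengths [alpha], from top to bottom. *)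
Definition is_ribbon (alpha lam mu : seq nat) : Prop :=
  [/\ is_skew_shape lam mu,
      no_2x2_square (diagram lam mu),
      alpha = [seq part lam i - part mu i | i <- iota 1 (size lam)],
      forall r, 1 <= r < size lam -> shared_columns lam mu r r.+1 <= 1 &
      forall r s, 1 <= r -> r.+1 < s <= size lam -> shared_columns lam mu r s = 0].

(* The number of cells of column [j] in the rows [i], [i.+1], ... *)
Definition column_length_from (lam mu : seq nat) (i j : nat) : nat :=
  count (fun x => (i <= x.1) && (x.2 == j)) (diagram lam mu).

Definition overlapping_partition (lam mu : seq nat) : seq nat :=
  [seq count (fun j => column_length_from lam mu i j == 2) (iota 1 (part lam 1))
     | i <- iota 1 (size lam)].

Definition pos_part (x : int) : int := Num.max 0%R x.

Definition varrho (alpha p : seq nat) (i : nat) : int :=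
  (1 + \sum_(i.+1 <= q < (size alpha).+1) (part alpha q)%:Z
     - (part p i.+1)%:Z)%R.

(* Main.v *)
Require Import Defs.
From mathcomp Require Import all_boot all_order all_algebra.
From mathcomp Require Import mpoly zify.

(** Reading the rows of the ribbon from top to bottom, each from right to left,
    turns its tableaux into words that are weakly decreasing along the rows and
    strictly increasing at the overlaps. Dropping an overlap condition, or
    replacing it by its opposite (which merges the two rows), gives a recursion
    that ends with products of complete homogeneous polynomials. Chains of
    horizontal strips satisfy the same recursion and, by the Pieri rule, the same
    initial conditions. Hence [c_nu] counts the chains
    [nu = nu^0 > nu^1 > ... > nu^l = 0] of horizontal strips of sizes
    [alpha_1, ..., alpha_l] in which every overlap forces a descent.

    With [A_i = alpha_i + ... + alpha_(l-1)] and [p_i] the number of overlaps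
    from row [i] on (indices from 0), such a chain exists if and only if [nu]
    dominates [alpha] and [nu_i + p_i <= A_i] for all [i]. Necessity holds because
    [nu_i] is at most the first row of [nu^i] and each descent puts a cell outside
    the first row. For sufficiency, [nu^1] is the most dominant partition that
    respects these bounds and misses the last cell of the last longest row of [nu].
    The inequality of the theorem for [i] says exactly that no partition that
    dominates [alpha] violates the bound at [i]. *)

Set Implicit Arguments.
Unset Strict Implicit.
Unset Printing Implicit Defensive.

Import Order.TTheory GRing.Theory Num.Theory.

Local Open Scope nat_scope.

(** * Sums and big operators *)

Lemma sum_ord_recl (f : nat -> nat) n : \sum_(i < n.+1) f i = f 0 + \sum_(i < n) f i.+1.
Proof. exact: big_ord_recl. Qed.

Lemma sum_ord_recr (f : nat -> nat) n : \sum_(i < n.+1) f i = \sum_(i < n) f i + f n.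
Proof. exact: big_ord_recr. Qed.

Lemma sumn_take_nth (s : seq nat) k : sumn (take k s) = \sum_(i < k) nth 0 s i.
Proof.
elim: s k => [|x s IHs] [|k] //=; rewrite ?big_ord0 //.
  by rewrite big1 // => i _; rewrite nth_nil.
by rewrite sum_ord_recl IHs.
Qed.

Lemma sum_nth (s : seq nat) k : size s <= k -> \sum_(i < k) nth 0 s i = sumn s.
Proof. by move=> size_le; rewrite -sumn_take_nth take_oversize. Qed.

Lemma sumn_take_drop (s : seq nat) k : sumn (take k s) + sumn (drop k s) = sumn s.
Proof. by rewrite -sumn_cat cat_take_drop. Qed.

Lemma leq_sumn_take (s : seq nat) k : sumn (take k s) <= sumn s.
Proof. by rewrite -(sumn_take_drop s k) leq_addr. Qed.

Lemma sumn_takeS (s : seq nat) k : sumn (take k.+1 s) = sumn (take k s) + nth 0 s k.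
Proof. by rewrite !sumn_take_nth sum_ord_recr. Qed.

Lemma sumn_dropS (s : seq nat) k : sumn (drop k s) = nth 0 s k + sumn (drop k.+1 s).
Proof.
case: (ltnP k (size s)) => [lt_size|ge_size]; first by rewrite (drop_nth 0).
by rewrite nth_default // !drop_oversize // leqW.
Qed.

Lemma leq_sumn (s t : seq nat) : (forall i, nth 0 s i <= nth 0 t i) -> sumn s <= sumn t.
Proof.
move=> le_st; rewrite -(@sum_nth s (size s + size t)) ?leq_addr //.
by rewrite -(@sum_nth t (size s + size t)) ?leq_addl // leq_sum.
Qed.

Lemma ltn_sumn (s t : seq nat) j :
  (forall i, nth 0 s i <= nth 0 t i) -> nth 0 s j < nth 0 t j -> sumn s < sumn t.
Proof.
move=> le_st lt_j; rewrite -(sumn_take_drop s j) -(sumn_take_drop t j) !(sumn_dropS _ j).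
have le_take : sumn (take j s) <= sumn (take j t) by rewrite !sumn_take_nth leq_sum.
have le_drop : sumn (drop j.+1 s) <= sumn (drop j.+1 t).
  by apply: leq_sumn => i; rewrite !nth_drop.
lia.
Qed.

Lemma exists_nth_lt (s t : seq nat) : sumn s < sumn t -> exists i, nth 0 s i < nth 0 t i.
Proof.
case: (boolP [exists i : 'I_(size t), nth 0 s i < nth 0 t i]) => [/existsP[i lt_i] _|].
  by exists i.
move/existsPn=> ge_st; rewrite ltnNge => /negP[]; apply: leq_sumn => i.
case: (ltnP i (size t)) => [lt_size|ge_size]; first by rewrite leqNgt (ge_st (Ordinal lt_size)).
by rewrite (nth_default _ ge_size).
Qed.

Lemma leq_sum_prefix (f : nat -> nat) i k : i <= k -> \sum_(j < i) f j <= \sum_(j < k) f j.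
Proof.
by move=> leik; rewrite (big_ord_widen k f leik) big_mkcond leq_sum // => j _; case: ifP.
Qed.

Lemma leq_sum_positive (f : nat -> nat) i k : i <= k -> (forall j, i <= j < k -> 0 < f j) ->
  \sum_(j < i) f j + (k - i) <= \sum_(j < k) f j.
Proof.
move=> leik; rewrite -(subnKC leik); elim: (k - i) => [|d IHd] f_gt0.
  by rewrite addn0 subnn addn0.
rewrite addnS sum_ord_recr; have := f_gt0 (i + d).
by have := IHd (fun j in_range => f_gt0 j ltac:(lia)); lia.
Qed.

Lemma nonincr_homo (f : nat -> nat) :
  (forall i, f i.+1 <= f i) -> {homo f : i j /~ i <= j}.
Proof.
move=> f_dec i j; apply: (@homo_leq _ f (fun a b => b <= a)) => // y x z xy yz.
exact: leq_trans yz xy.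
Qed.

Lemma leq_sum_nonincr (f : nat -> nat) k : {homo f : i j /~ i <= j} ->
  f 0 + k * f k <= \sum_(j < k.+1) f j.
Proof.
move=> f_homo; rewrite sum_ord_recl leq_add2l -[X in X * _](card_ord k) -sum_nat_const.
by apply: leq_sum => j _; apply: f_homo.
Qed.

Lemma geq_sum_nonincr (f : nat -> nat) k : {homo f : i j /~ i <= j} ->
  \sum_(j < k) f j <= k * f 0.
Proof.
move=> f_homo; rewrite -[X in X * _](card_ord k) -sum_nat_const.
by apply: leq_sum => j _; apply: f_homo.
Qed.

Lemma sum_maxn (f : nat -> nat) r k :
  \sum_(j < k) maxn (f j) r = \sum_(j < k) f j + \sum_(j < k) (r - f j).
Proof. by rewrite -big_split /=; apply: eq_bigr => j _; rewrite maxnE. Qed.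

(* [E] units distributed over boxes of capacities [d 0], [d 1], ..., filling the
   first boxes first. *)
Definition greedy_fill (d : nat -> nat) E i := minn (d i) (E - \sum_(j < i) d j).

Lemma leq_greedy_fill d E i : greedy_fill d E i <= d i.
Proof. exact: geq_minl. Qed.

Lemma sum_greedy_fill d E k : \sum_(i < k) greedy_fill d E i = minn E (\sum_(i < k) d i).
Proof.
elim: k => [|k IHk]; first by rewrite !big_ord0 minn0.
rewrite !sum_ord_recr IHk /greedy_fill; move: (\sum_(i < k) d i) => s; lia.
Qed.

Lemma eq_big_seq_cond (R : Type) (idx : R) (op : R -> R -> R) (I : eqType) (r : seq I)
    (P : pred I) (F G : I -> R) :
  (forall i, i \in r -> P i -> F i = G i) ->
  \big[op/idx]_(i <- r | P i) F i = \big[op/idx]_(i <- r | P i) G i.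
Proof.
move=> eqFG; rewrite big_seq_cond [RHS]big_seq_cond.
by apply: eq_bigr => i /andP[]; apply: eqFG.
Qed.

Lemma big_seq_sub (R : Type) (idx : R) (op : Monoid.com_law idx) (T : choiceType)
    (D : seq T) (f : T -> R) : uniq D ->
  \big[op/idx]_(x : seq_sub D) f (val x) = \big[op/idx]_(c <- D) f c.
Proof.
move=> D_uniq; rewrite -(big_map val predT f); apply: perm_big; apply: uniq_perm => //.
  by rewrite map_inj_uniq ?index_enum_uniq //; apply: val_inj.
move=> c; apply/mapP/idP => [[x _ ->]|cD]; first exact: valP.
by exists (SeqSub cD); rewrite ?mem_index_enum.
Qed.

Lemma card_seq_sub_pred (T : choiceType) (D : seq T) (P : pred T) :
  uniq D -> #|[pred x : seq_sub D | P (val x)]| = count P D.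
Proof.
move=> D_uniq; rewrite -sum1_card -sum1_count [LHS]big_mkcond [RHS]big_mkcond.
exact: (big_seq_sub _ (fun c => if P c then 1 else 0)).
Qed.

Lemma partition_big_seq (R : Type) (idx : R) (op : Monoid.com_law idx) (I : finType) (J : eqType)
    (s : seq J) (h : I -> J) (P : pred I) (F : I -> R) :
  uniq s -> (forall i, P i -> h i \in s) ->
  \big[op/idx]_(i | P i) F i = \big[op/idx]_(j <- s) \big[op/idx]_(i | P i && (h i == j)) F i.
Proof.
move=> s_uniq h_in.
transitivity (\big[op/idx]_(j <- s) \big[op/idx]_(i | P i) if h i == j then F i else idx).
  rewrite exchange_big /=; apply: eq_bigr => i Pi.
  rewrite (bigD1_seq (h i)) ?h_in //= eqxx big1 ?Monoid.mulm1 // => j j_neq.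
  by rewrite eq_sym (negbTE j_neq).
by apply: eq_bigr => j _; rewrite big_mkcondr.
Qed.

Lemma big_tuple_cons (R : Type) (idx : R) (op : Monoid.com_law idx) (T : finType) m
    (P : pred (m.+1.-tuple T)) (F : m.+1.-tuple T -> R) :
  \big[op/idx]_(t | P t) F t =
  \big[op/idx]_(a : T) \big[op/idx]_(t : m.-tuple T | P [tuple of a :: t]) F [tuple of a :: t].
Proof.
rewrite pair_big_dep /= (reindex (fun p : T * m.-tuple T => [tuple of p.1 :: p.2])) //=.
exists (fun t : m.+1.-tuple T => (thead t, [tuple of behead t])) => [[a t] _|t _] /=.
  by congr (_, _); apply: val_inj.
by rewrite -tuple_eta.
Qed.

Lemma eq_count_can (T1 T2 : eqType) (s1 : seq T1) (s2 : seq T2) (P1 : pred T1) (P2 : pred T2)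
    (f : T1 -> T2) (g : T2 -> T1) :
  uniq s1 -> uniq s2 ->
  (forall x, x \in s1 -> P1 x -> [/\ f x \in s2, P2 (f x) & g (f x) = x]) ->
  (forall y, y \in s2 -> P2 y -> [/\ g y \in s1, P1 (g y) & f (g y) = y]) ->
  count P1 s1 = count P2 s2.
Proof.
move=> s1_uniq s2_uniq fP gP; rewrite -!size_filter -(size_map f); apply: perm_size.
apply: uniq_perm; rewrite ?filter_uniq //.
  rewrite map_inj_in_uniq ?filter_uniq // => x y; rewrite !mem_filter.
  by move=> /andP[Px /fP/(_ Px)[_ _ {2}<-]] /andP[Py /fP/(_ Py)[_ _ {2}<-]] ->.
move=> y; rewrite mem_filter; apply/mapP/andP => [[x]|[P2y /gP/(_ P2y)[gy P1gy fgy]]].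
  by rewrite mem_filter => /andP[Px /fP/(_ Px)[? ? _]] ->.
by exists (g y); rewrite ?mem_filter ?P1gy.
Qed.

Lemma count_initial_segment (P : pred nat) N :
  (forall i j, i < j < N -> P j -> P i) ->
  forall j, j < N -> P j = (j < count P (iota 0 N)).
Proof.
elim: N => // N IHN P_down j; rewrite ltnS -[in iota _ _]addn1 iotaD count_cat /= addn0 add0n.
case: (boolP (P N)) => [PN lejN|PN]; last first.
  rewrite addn0 leq_eqVlt => /predU1P[->|].
    by rewrite (negbTE PN) ltnNge -{2}(size_iota 0 N) count_size.
  by apply: IHN => i k /andP[ltik ltkN]; apply: P_down; rewrite ltik ltnW.
have P_all i : i <= N -> P i.
  by rewrite leq_eqVlt => /predU1P[->|ltiN] //; apply: (P_down i N); rewrite ?ltiN /=.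
rewrite P_all // (eq_in_count (a2 := predT)) ?count_predT ?size_iota ?addn1 //= => i.
by rewrite mem_iota => /andP[_ ltiN]; rewrite P_all // ltnW.
Qed.

(** * Partitions and horizontal strips *)

Lemma sorted_geq_nth (s : seq nat) : sorted geq s -> {homo nth 0 s : i j /~ i <= j}.
Proof.
move=> s_sorted; apply: nonincr_homo => i.
case: (ltnP i.+1 (size s)) => [lt_size|ge_size]; last by rewrite nth_default.
exact: (sortedP 0 s_sorted).
Qed.

Lemma partition_nth_homo s : is_partition s -> {homo nth 0 s : i j /~ i <= j}.
Proof. by case/andP=> s_sorted _; apply: sorted_geq_nth. Qed.

Lemma partition_nthS s i : is_partition s -> nth 0 s i.+1 <= nth 0 s i.
Proof. by move=> s_part; apply: partition_nth_homo. Qed.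

Lemma part_homo s i j : is_partition s -> 0 < i -> i <= j -> part s j <= part s i.
Proof. by move=> s_part i_gt0 leij; apply: partition_nth_homo => //; lia. Qed.

Lemma part_default s i : size s < i -> part s i = 0.
Proof. by move=> gt_size; rewrite /part nth_default //; lia. Qed.

Lemma partition_nth_gt0 s i : is_partition s -> (0 < nth 0 s i) = (i < size s).
Proof.
case/andP=> _ s_pos; case: (ltnP i (size s)) => [lt_size|ge_size]; last by rewrite nth_default.
by rewrite lt0n; apply: contra s_pos => /eqP <-; apply: mem_nth.
Qed.

Lemma partition_size_leq s k : is_partition s -> (size s <= k) = (nth 0 s k == 0).
Proof. by move=> s_part; rewrite leqNgt -partition_nth_gt0 // lt0n negbK. Qed.

Lemma eq_partition s t : is_partition s -> is_partition t -> nth 0 s =1 nth 0 t -> s = t.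
Proof.
move=> s_part t_part eqst; apply: (@eq_from_nth _ 0) => [|i _]; last exact: eqst.
have lt_size i : (i < size s) = (i < size t) by rewrite -!partition_nth_gt0 // eqst.
by apply/eqP; rewrite eqn_leq leqNgt lt_size ltnn /= leqNgt -lt_size ltnn.
Qed.

Lemma size_partition_le s : is_partition s -> size s <= sumn s.
Proof.
case/andP=> _; elim: s => //= x s IHs; rewrite inE negb_or => /andP[x_neq0 /IHs]; lia.
Qed.

Lemma partition_sumn0 s : is_partition s -> (sumn s == 0) = (s == [::]).
Proof. by case: s => //= x s /andP[_]; rewrite inE negb_or addn_eq0; case: x. Qed.

Section PartitionOfFunction.
Variables (f : nat -> nat) (K : nat).
Hypotheses (f_dec : forall i, f i.+1 <= f i) (fK0 : f K = 0).

Definition partition_of := [seq x <- mkseq f K | 0 < x].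

Lemma is_partition_of : is_partition partition_of.
Proof.
rewrite /is_partition mem_filter andbT sorted_filter //.
  by move=> x y z /= xy yz; apply: leq_trans yz xy.
apply/(sortedP 0) => i; rewrite size_mkseq => ltiK.
rewrite !nth_mkseq ?(ltnW ltiK) //; exact: f_dec.
Qed.

Lemma partition_of_support :
  exists2 k, partition_of = mkseq f k & forall i, k <= i -> f i = 0.
Proof.
have exf : exists k, f k == 0 by exists K; rewrite fK0.
case: (ex_minnP exf) => k /eqP fk0 min_k; have lekK : k <= K by apply: min_k; rewrite fK0.
have f0 i : k <= i -> f i = 0 by move/(nonincr_homo f_dec); rewrite fk0 leqn0 => /eqP.
exists k => //; rewrite /partition_of /mkseq -(subnKC lekK) iotaD map_cat filter_cat.
rewrite (all_filterP _) => [|]; last first.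
  apply/allP => _ /mapP[i + ->]; rewrite mem_iota lt0n => ltik.
  by apply: contraTN ltik => /min_k; rewrite -leqNgt.
rewrite (eq_in_filter (a2 := pred0)) ?filter_pred0 ?cats0 // => _ /mapP[i + ->].
by rewrite mem_iota => /andP[leki _]; rewrite f0.
Qed.

Lemma nth_partition_of i : nth 0 partition_of i = f i.
Proof.
have [k -> f0] := partition_of_support; case: (ltnP i k) => [|leki]; first exact: nth_mkseq.
by rewrite nth_default ?size_mkseq ?f0.
Qed.

Lemma size_partition_of : size partition_of <= K.
Proof. by rewrite size_filter -[X in _ <= X](size_mkseq f) count_size. Qed.

Lemma sumn_partition_of : sumn partition_of = \sum_(i < K) f i.
Proof.
by rewrite -(sum_nth size_partition_of); apply: eq_bigr => i _; rewrite nth_partition_of.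
Qed.

End PartitionOfFunction.

Definition partitions_upto M := undup (flatten [seq partitions k | k <- iota 0 M.+1]).

Lemma mem_partitions_upto M s : (s \in partitions_upto M) = is_partition s && (sumn s <= M).
Proof.
rewrite mem_undup; apply/flatten_mapP/andP => [[k]|[s_part s_le]].
  by rewrite mem_iota => k_range; rewrite mem_partitions => /andP[-> /eqP ->]; lia.
by exists (sumn s); rewrite ?mem_iota ?mem_partitions ?s_part /=; lia.
Qed.

Lemma partitions_upto_uniq M : uniq (partitions_upto M).
Proof. exact: undup_uniq. Qed.

Lemma perm_partitions_upto k M :
  k <= M -> perm_eq (partitions k) [seq s <- partitions_upto M | sumn s == k].
Proof.
move=> lekM; apply: uniq_perm; rewrite ?partitions_uniq ?filter_uniq ?undup_uniq // => s.
rewrite mem_partitions mem_filter mem_partitions_upto.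
by case: eqP => [->|]; rewrite ?lekM ?andbT ?andbF.
Qed.

Lemma perm_partitions0 : perm_eq (partitions 0) [:: [::]].
Proof.
apply: uniq_perm; rewrite ?partitions_uniq // => s; rewrite mem_partitions inE.
by apply/andP/eqP => [[s_part]|-> //]; rewrite partition_sumn0 // => /eqP.
Qed.

Definition hstrip (nu ka : seq nat) : bool :=
  all (fun i => nth 0 nu i.+1 <= nth 0 ka i <= nth 0 nu i) (iota 0 (size nu + size ka)).

Lemma hstripP nu ka :
  reflect (forall i, nth 0 nu i.+1 <= nth 0 ka i <= nth 0 nu i) (hstrip nu ka).
Proof.
apply: (iffP allP) => [strip i|strip i _ //].
case: (ltnP i (size nu + size ka)) => [lt_size|ge_size]; last by rewrite !nth_default //; lia.
by apply: strip; rewrite mem_iota.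
Qed.

Lemma hstrip_nth_le nu ka i : hstrip nu ka -> nth 0 ka i <= nth 0 nu i.
Proof. by move/hstripP/(_ i)/andP=> []. Qed.

Lemma hstrip_nthS_le nu ka i : hstrip nu ka -> nth 0 nu i.+1 <= nth 0 ka i.
Proof. by move/hstripP/(_ i)/andP=> []. Qed.

Lemma hstrip_sumn nu ka : hstrip nu ka -> sumn ka <= sumn nu.
Proof. by move=> strip; apply: leq_sumn => i; apply: hstrip_nth_le. Qed.

Definition strip_removals a nu : seq (seq nat) :=
  [seq ka <- partitions (sumn nu - a) | (a <= sumn nu) && hstrip nu ka].

Lemma strip_removalsP a nu ka :
  reflect [/\ is_partition ka, sumn nu = sumn ka + a & hstrip nu ka]
          (ka \in strip_removals a nu).
Proof.
rewrite mem_filter mem_partitions.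
apply: (iffP and3P) => [[/andP[le_a strip] ka_part /eqP ka_sum]|[ka_part -> strip]].
  by split=> //; rewrite ka_sum subnK.
by rewrite leq_addl addnK strip.
Qed.

(* Equivalently, the last entry of [nu / ka] is a descent of the standardization of
   the chain. *)
Definition descent (ka nu rho : seq nat) : bool :=
  has (fun j => (nth 0 nu j < nth 0 rho j) &&
         has (fun i => nth 0 ka i < nth 0 nu i) (iota 0 j)) (iota 0 (size rho)).

Lemma descentP ka nu rho :
  reflect (exists i j, [/\ i < j, nth 0 ka i < nth 0 nu i & nth 0 nu j < nth 0 rho j])
          (descent ka nu rho).
Proof.
apply: (iffP hasP) => [[j _ /andP[ltj /hasP[i]]]|[i [j [ltij lti ltj]]]].
  by rewrite mem_iota => /andP[_ ltij] lti; exists i, j.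
exists j; last by rewrite ltj; apply/hasP; exists i; rewrite ?mem_iota.
rewrite mem_iota leq0n /= ltnNge; apply: contraL ltj => ge_size.
by rewrite -leqNgt (nth_default _ ge_size).
Qed.

(** * The Pieri rule *)

(* The local rule of the Robinson-Schensted-Knuth correspondence, in the form of
   Fomin's growth diagrams: [nu] and [ka] both cover [rho] and are both covered by
   [th], where strips play the role of covers. Both conditions only involve the
   row-wise maximum [hi] and minimum [lo] of [nu] and [ka], and the rule reflects
   row [i] of [rho] in the interval [[hi i.+1, lo i]] to get row [i.+1] of [th]. *)
Section LocalRule.
Variables (nu ka : seq nat) (N : nat).
Let hi i := maxn (nth 0 nu i) (nth 0 ka i).
Let lo i := minn (nth 0 nu i) (nth 0 ka i).
Let K := (size nu + size ka).+1.

Definition strips_below rho := hstrip nu rho && hstrip ka rho.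
Definition strips_above th := hstrip th nu && hstrip th ka.

Lemma strips_belowP rho : reflect (forall i, hi i.+1 <= nth 0 rho i <= lo i) (strips_below rho).
Proof.
apply: (iffP andP) => [[/hstripP nu_rho /hstripP ka_rho] i|rhoP].
  by have := nu_rho i; have := ka_rho i; rewrite /hi /lo; lia.
by split; apply/hstripP => i; have := rhoP i; rewrite /hi /lo; lia.
Qed.

Lemma strips_aboveP th :
  reflect (forall i, (hi i <= nth 0 th i) && (nth 0 th i.+1 <= lo i)) (strips_above th).
Proof.
apply: (iffP andP) => [[/hstripP th_nu /hstripP th_ka] i|thP].
  by have := th_nu i; have := th_ka i; rewrite /hi /lo; lia.
by split; apply/hstripP => i; have := thP i; rewrite /hi /lo; lia.
Qed.

Let hi_vanish i : K <= i.+1 -> hi i = 0.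
Proof. by rewrite /hi /K ltnS => ge_size; rewrite !nth_default //; lia. Qed.

Let lo_le_hi i : lo i <= hi i. Proof. by rewrite /lo /hi; lia. Qed.

Let strips_below_row rho i : strips_below rho -> hi i.+1 <= nth 0 rho i <= lo i.
Proof. by move/strips_belowP. Qed.

Let strips_above_row0 th : strips_above th -> hi 0 <= nth 0 th 0.
Proof. by case/strips_aboveP/(_ 0)/andP. Qed.

Let strips_above_rowS th i : strips_above th -> hi i.+1 <= nth 0 th i.+1 <= lo i.
Proof. by move/strips_aboveP=> thP; case/andP: (thP i) => _ ->; case/andP: (thP i.+1) => ->. Qed.

Lemma sumn_reflect rho th :
  is_partition rho -> is_partition th -> strips_below rho -> strips_above th ->
  (forall i, nth 0 th i.+1 + nth 0 rho i = hi i.+1 + lo i) ->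
  sumn th + sumn rho + hi 0 = nth 0 th 0 + (sumn nu + sumn ka).
Proof.
move=> rho_part th_part below above row_reflect.
have lo_vanish i : K <= i.+1 -> lo i = 0.
  by move=> ge_K; have := lo_le_hi i; rewrite hi_vanish // leqn0 => /eqP.
have rho_size : size rho <= K.
  by rewrite partition_size_leq //; have := strips_below_row K below; rewrite lo_vanish; lia.
have th_size : size th <= K.+1.
  by rewrite partition_size_leq //; have := strips_above_rowS K above; rewrite lo_vanish; lia.
have sum_hi_lo : \sum_(i < K.+1) hi i + \sum_(i < K.+1) lo i = sumn nu + sumn ka.
  rewrite -(@sum_nth nu K.+1) -?(@sum_nth ka K.+1) -?big_split /= /K; try lia.
  by apply: eq_bigr => i _; rewrite /hi /lo; lia.
have sum_reflect : \sum_(i < K) nth 0 th i.+1 + \sum_(i < K) nth 0 rho i =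
    \sum_(i < K) hi i.+1 + \sum_(i < K) lo i.
  by rewrite -!big_split; apply: eq_bigr => i _; apply: row_reflect.
rewrite -sum_hi_lo -(sum_nth rho_size) -(sum_nth th_size) sum_ord_recl (sum_ord_recl hi).
by rewrite (sum_ord_recr lo) lo_vanish //; move: sum_reflect => /=; lia.
Qed.

Definition join_row rho i :=
  if i is i'.+1 then hi i + lo i' - nth 0 rho i' else hi 0 + (N + sumn rho - (sumn nu + sumn ka)).
Definition meet_row th i := hi i.+1 + lo i - nth 0 th i.+1.
Definition join_partition rho := partition_of (join_row rho) K.
Definition meet_partition th := partition_of (meet_row th) K.

Section Join.
Variable rho : seq nat.
Hypothesis below : strips_below rho.

Let join_row_dec i : join_row rho i.+1 <= join_row rho i.
Proof.
have := lo_le_hi i; have := strips_below_row i below; case: i => [|i] /=; first by lia.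
by have := strips_below_row i below; lia.
Qed.

Let join_row_vanish : join_row rho K = 0.
Proof. by rewrite /= hi_vanish //; have := lo_le_hi K.-1; rewrite hi_vanish //=; lia. Qed.

Lemma is_partition_join : is_partition (join_partition rho).
Proof. exact: is_partition_of join_row_dec. Qed.

Lemma nth_join_partition i : nth 0 (join_partition rho) i = join_row rho i.
Proof. exact: nth_partition_of join_row_dec join_row_vanish i. Qed.

Lemma join_partition_above : strips_above (join_partition rho).
Proof.
apply/strips_aboveP => i; rewrite !nth_join_partition /=.
have := lo_le_hi i; have := strips_below_row i below; case: i => [|i] /=; first by lia.
by have := strips_below_row i below; lia.
Qed.

Lemma sumn_join_partition : is_partition rho -> sumn nu + sumn ka <= N + sumn rho ->
  sumn (join_partition rho) = N.
Proof.
move=> rho_part le_sum.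
have := sumn_reflect rho_part is_partition_join below join_partition_above.
rewrite nth_join_partition /= => sum_eq; suff /sum_eq : forall i,
  nth 0 (join_partition rho) i.+1 + nth 0 rho i = hi i.+1 + lo i by lia.
by move=> i; rewrite nth_join_partition /=; have := strips_below_row i below; lia.
Qed.

End Join.

Section Meet.
Variable th : seq nat.
Hypothesis above : strips_above th.

Let meet_row_dec i : meet_row th i.+1 <= meet_row th i.
Proof.
have := strips_above_rowS i above; have := strips_above_rowS i.+1 above.
by have := lo_le_hi i.+1; rewrite /meet_row; lia.
Qed.

Let meet_row_vanish : meet_row th K = 0.
Proof. by rewrite /meet_row hi_vanish //; have := lo_le_hi K; rewrite hi_vanish //; lia. Qed.

Lemma is_partition_meet : is_partition (meet_partition th).
Proof. exact: is_partition_of meet_row_dec. Qed.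

Lemma nth_meet_partition i : nth 0 (meet_partition th) i = meet_row th i.
Proof. exact: nth_partition_of meet_row_dec meet_row_vanish i. Qed.

Lemma meet_partition_below : strips_below (meet_partition th).
Proof.
apply/strips_belowP => i; rewrite nth_meet_partition /meet_row.
by have := strips_above_rowS i above; lia.
Qed.

Lemma sumn_meet_partition : is_partition th ->
  sumn th + sumn (meet_partition th) + hi 0 = nth 0 th 0 + (sumn nu + sumn ka).
Proof.
move=> th_part.
apply: (sumn_reflect is_partition_meet th_part meet_partition_below above) => i.
rewrite nth_meet_partition /meet_row.
by have := strips_above_rowS i above; lia.
Qed.

End Meet.

Lemma join_partitionK rho : is_partition rho -> strips_below rho ->
  meet_partition (join_partition rho) = rho.
Proof.
move=> rho_part below; have above := join_partition_above below.
apply: eq_partition => // [|i]; first exact: is_partition_meet.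
rewrite nth_meet_partition // /meet_row nth_join_partition //=.
by have := strips_below_row i below; lia.
Qed.

Lemma meet_partitionK th : is_partition th -> strips_above th -> sumn th = N ->
  join_partition (meet_partition th) = th.
Proof.
move=> th_part above th_sum; have below := meet_partition_below above.
apply: eq_partition => // [|[|i]]; first exact: is_partition_join.
  rewrite nth_join_partition //=; have := sumn_meet_partition above th_part.
  by have := strips_above_row0 above; lia.
rewrite nth_join_partition //= nth_meet_partition // /meet_row.
by have := strips_above_rowS i above; lia.
Qed.

Lemma local_rule_count :
  count (fun rho => strips_below rho && (sumn nu + sumn ka <= N + sumn rho))
        (partitions_upto (sumn nu)) =
  count strips_above (partitions N).
Proof.
apply: (eq_count_can (f := join_partition) (g := meet_partition)).
- exact: partitions_upto_uniq.
- exact: partitions_uniq.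
- move=> rho; rewrite mem_partitions_upto => /andP[rho_part _] /andP[below le_sum].
  split; [|exact: join_partition_above|exact: join_partitionK].
  by rewrite mem_partitions is_partition_join // sumn_join_partition /=.
move=> th; rewrite mem_partitions => /andP[th_part /eqP th_sum] above.
have below := meet_partition_below above; split; last exact: meet_partitionK.
  by rewrite mem_partitions_upto is_partition_meet // hstrip_sumn //; case/andP: below.
rewrite below /=; have := sumn_meet_partition above th_part.
by have := strips_above_row0 above; lia.
Qed.

End LocalRule.

Local Open Scope ring_scope.

Section Pieri.
Variables (R : comPzRingType) (x : nat -> R).

(* The branching rule: [ka] is the shape of the entries below [n']. *)
Fixpoint schur_poly (n : nat) (nu : seq nat) : R :=
  if n is n'.+1 then
    \sum_(ka <- partitions_upto (sumn nu) | hstrip nu ka)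
       x n' ^+ (sumn nu - sumn ka) * schur_poly n' ka
  else (nu == [::])%:R.

Fixpoint complete_poly (n a : nat) : R :=
  if n is n'.+1 then \sum_(i < a.+1) x n' ^+ (a - i) * complete_poly n' i
  else (a == 0%N)%:R.

Lemma complete_poly0 n : complete_poly n 0 = 1.
Proof. by elim: n => [|n IHn] //=; rewrite big_ord1 IHn mulr1. Qed.

Lemma complete_polyS n a :
  complete_poly n.+1 a.+1 = complete_poly n a.+1 + x n * complete_poly n.+1 a.
Proof.
rewrite /= big_ord_recr /= subnn mul1r addrC mulr_sumr; congr (_ + _).
apply: eq_bigr => i _; rewrite mulrA -exprS; congr (_ ^+ _ * _).
by have := ltn_ord i; lia.
Qed.

Lemma schur_poly_nil n : schur_poly n [::] = 1.
Proof.
elim: n => [|n IHn] //=.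
rewrite big_mkcond (perm_big [:: [::]]) /=; first by rewrite big_seq1 IHn mulr1.
apply: uniq_perm => // [|s]; first exact: partitions_upto_uniq.
rewrite mem_partitions_upto inE leqn0.
by apply/andP/eqP => [[ps]|-> //]; rewrite partition_sumn0 // => /eqP.
Qed.

Definition pieri_rule n :=
  forall a rho, is_partition rho -> complete_poly n a * schur_poly n rho =
    \sum_(ka <- partitions (sumn rho + a) | hstrip ka rho) schur_poly n ka.

Lemma pieri0 : pieri_rule 0.
Proof.
move=> a nu nu_part; rewrite -natrM mulnb -(partition_sumn0 nu_part).
case: (posnP (sumn nu + a)) => [sum0|sum_gt0].
  have [-> ->] : a = 0%N /\ nu = [::].
    by split; [|apply/eqP; rewrite -partition_sumn0 //]; lia.
  by rewrite (perm_big _ perm_partitions0) big_mkcond big_seq1.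
rewrite big1_seq => [|th]; last first.
  rewrite mem_partitions => /andP[_ /andP[th_part /eqP th_sum]].
  by rewrite /= -partition_sumn0 // th_sum eqn0Ngt sum_gt0.
by have -> : (a == 0%N) && (sumn nu == 0%N) = false by lia.
Qed.

Lemma sum_above_schur_polyS n N nu :
  \sum_(th <- partitions N | hstrip th nu) schur_poly n.+1 th =
  \sum_(ka <- partitions_upto N)
     (x n ^+ (N - sumn ka) * schur_poly n ka) *+ count (strips_above nu ka) (partitions N).
Proof.
transitivity (\sum_(th <- partitions N | hstrip th nu)
    \sum_(ka <- partitions_upto N | hstrip th ka) x n ^+ (N - sumn ka) * schur_poly n ka).
  by apply: eq_big_seq_cond => th; rewrite mem_partitions => /andP[_ /eqP <-].
rewrite (exchange_big_dep predT) //=; apply: eq_bigr => ka _.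
by rewrite big_const_seq -Monoid.iteropE.
Qed.

Lemma complete_polyS_mul_schur n a k rho : pieri_rule n -> is_partition rho ->
  let N := (sumn rho + a + k)%N in
  complete_poly n.+1 a * (x n ^+ k * schur_poly n rho) =
  \sum_(ka <- partitions_upto N | hstrip ka rho && (sumn ka <= sumn rho + a)%N)
     x n ^+ (N - sumn ka) * schur_poly n ka.
Proof.
move=> pieri_n rho_part N; rewrite mulr_suml.
transitivity (\sum_(i < a.+1) \sum_(ka <- partitions_upto N | hstrip ka rho)
   if (sumn ka == sumn rho + i)%N then x n ^+ (N - sumn ka) * schur_poly n ka else 0).
  apply: eq_bigr => i _; have lt_i := ltn_ord i.
  have le_N : (sumn rho + i <= N)%N by rewrite /N; lia.
  rewrite -big_mkcondr -mulrA [complete_poly n i * _]mulrCA pieri_n // mulrA -exprD.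
  rewrite (perm_big _ (perm_partitions_upto le_N)) /= big_filter_cond mulr_sumr.
  apply: eq_big => [ka|ka /andP[/eqP -> _]]; first by rewrite andbC.
  by congr (_ ^+ _ * _); rewrite /N; lia.
rewrite exchange_big /= [RHS]big_mkcondr /=; apply: eq_bigr => ka strip.
have le_sum := hstrip_sumn strip; case: leqP => [le_a|gt_a]; last first.
  by rewrite big1 // => i _; case: eqP => //; have := ltn_ord i; lia.
have lt_a : (sumn ka - sumn rho < a.+1)%N by lia.
rewrite (bigD1 (Ordinal lt_a)) //= subnKC // eqxx big1 ?addr0 // => i i_neq.
by case: eqP => // ka_sum; case/eqP: i_neq; apply: val_inj => /=; lia.
Qed.

Lemma complete_polyS_mul_schurS n a nu : pieri_rule n ->
  let N := (sumn nu + a)%N in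
  complete_poly n.+1 a * schur_poly n.+1 nu =
  \sum_(ka <- partitions_upto N)
     (x n ^+ (N - sumn ka) * schur_poly n ka) *+
     count (fun rho => strips_below nu ka rho && (sumn nu + sumn ka <= N + sumn rho)%N)
           (partitions_upto (sumn nu)).
Proof.
move=> pieri_n N.
transitivity (\sum_(rho <- partitions_upto (sumn nu) | hstrip nu rho)
  \sum_(ka <- partitions_upto N | hstrip ka rho && (sumn ka <= sumn rho + a)%N)
     x n ^+ (N - sumn ka) * schur_poly n ka).
  rewrite mulr_sumr; apply: eq_big_seq_cond => rho.
  rewrite mem_partitions_upto => /andP[rho_part rho_sum] _; rewrite complete_polyS_mul_schur //.
  by have -> : (sumn rho + a + (sumn nu - sumn rho) = N)%N by rewrite /N; lia.
rewrite (exchange_big_dep predT) //=; apply: eq_bigr => ka _.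
rewrite big_const_seq -Monoid.iteropE; congr (_ *+ _); apply: eq_count => rho.
by rewrite /strips_below /N andbA -addnA leq_add2l [(a + _)%N]addnC.
Qed.

Lemma pieri n : pieri_rule n.
Proof.
elim: n => [|n IHn] a nu nu_part; first exact: pieri0.
rewrite complete_polyS_mul_schurS // sum_above_schur_polyS.
by apply: eq_bigr => ka _; rewrite local_rule_count.
Qed.

End Pieri.

Local Close Scope ring_scope.

(** * Tableaux and the branching rule *)

Lemma mem_diagram lam mu i j :
  ((i, j) \in diagram lam mu) = (0 < i) && (part mu i < j <= part lam i).
Proof.
apply/allpairsPdep/andP => [[i' [j' [i_in j_in [-> ->]]]]|[i_gt0 j_range]].
  by move: i_in j_in; rewrite !mem_iota; lia.
exists i, j; split=> //; rewrite mem_iota; last by lia.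
by rewrite i_gt0 ltnS leqNgt; apply/negP => /(part_default (s := lam)); lia.
Qed.

Lemma diagram_uniq lam mu : uniq (diagram lam mu).
Proof.
by apply: allpairs_uniq_dep => [|i _|]; rewrite ?iota_uniq // => -[i j] [i' j'] _ _ [-> ->].
Qed.

Lemma size_diagram lam mu :
  size (diagram lam mu) = sumn [seq part lam i - part mu i | i <- iota 1 (size lam)].
Proof. by rewrite size_allpairs_dep; congr sumn; apply: eq_map => i; exact: size_iota. Qed.

Lemma mem_straight nu i j : ((i.+1, j.+1) \in diagram nu [::]) = (j < nth 0 nu i).
Proof. by rewrite mem_diagram /part nth_nil. Qed.

Lemma straight_cell nu c : c \in diagram nu [::] -> exists i j, c = (i.+1, j.+1).
Proof. by case: c => -[|i] [|j]; rewrite mem_diagram // ?andbF // => _; exists i, j. Qed.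

Lemma hstrip_straight_sub nu ka :
  hstrip nu ka -> {subset diagram ka [::] <= diagram nu [::]}.
Proof.
move=> strip c c_ka; have [i [j cE]] := straight_cell c_ka; move: c_ka.
by rewrite cE !mem_straight => /leq_trans; apply; apply: hstrip_nth_le.
Qed.

Lemma size_straight nu : size (diagram nu [::]) = sumn nu.
Proof.
rewrite size_diagram; congr sumn.
apply: (@eq_from_nth _ 0); rewrite size_map size_iota // => i lt_i.
by rewrite (nth_map 0) ?size_iota // nth_iota // /part nth_nil subn0 add1n.
Qed.

Lemma eq_straight nu nu' : is_partition nu -> is_partition nu' ->
  diagram nu [::] =i diagram nu' [::] -> nu = nu'.
Proof.
move=> nu_part nu'_part eqD; apply: eq_partition => // i.
have eq_row j : (j < nth 0 nu i) = (j < nth 0 nu' i) by rewrite -!mem_straight eqD.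
by have := eq_row (nth 0 nu i); have := eq_row (nth 0 nu' i); rewrite !ltnn; lia.
Qed.

Section Entries.
Variables (n : nat) (D : seq (nat * nat)).
Implicit Types (T : {ffun seq_sub D -> 'I_n}) (d : nat).

Definition entry d T (c : nat * nat) : nat := if insub c is Some x then val (T x) else d.

Lemma entry_val d T x : entry d T (val x) = T x.
Proof. by rewrite /entry insubT ?(valP x) // => x_in; congr (val (T _)); apply: val_inj. Qed.

Lemma entry_out d T c : c \notin D -> entry d T c = d.
Proof. by move=> cD; rewrite /entry insubN. Qed.

Lemma entry_ltP d T m :
  reflect (forall c, c \in D -> entry d T c < m) [forall x, T x < m].
Proof.
apply: (iffP forallP) => [ltT c cD|ltT x]; last by rewrite -(entry_val d) ltT ?(valP x).
by rewrite -[c]/(val (SeqSub cD)) entry_val.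
Qed.

Lemma ssytP d T :
  reflect [/\ forall i j j', (i, j) \in D -> (i, j') \in D -> j < j' ->
                entry d T (i, j) <= entry d T (i, j')
            & forall i i' j, (i, j) \in D -> (i', j) \in D -> i < i' ->
                entry d T (i, j) < entry d T (i', j)]
          (is_ssyt T).
Proof.
apply: (iffP forallP) => [ssyt|[rows cols] x]; last first.
  apply/forallP => y; case: x y => [[i j] ij] [[i' j'] ij'] /=.
  rewrite -(entry_val d T (SeqSub ij)) -(entry_val d T (SeqSub ij')) /=.
  apply/andP; split; apply/implyP => /andP[/eqP same_line before]; subst.
    exact: rows.
  exact: cols.
split=> [i j j' ij ij' ltjj'|i i' j ij i'j ltii'].
  have /forallP/(_ (SeqSub ij'))/andP[] := ssyt (SeqSub ij).
  by rewrite /= eqxx ltjj' -(entry_val d T (SeqSub ij)) -(entry_val d T (SeqSub ij')).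
have /forallP/(_ (SeqSub i'j))/andP[_] := ssyt (SeqSub ij).
by rewrite /= eqxx ltii' -(entry_val d T (SeqSub ij)) -(entry_val d T (SeqSub i'j)).
Qed.

End Entries.

Lemma entry_ext n (D : seq (nat * nat)) d (T T' : {ffun seq_sub D -> 'I_n}) :
  {in D, entry d T =1 entry d T'} -> T = T'.
Proof.
by move=> eqT; apply/ffunP => x; apply: val_inj; rewrite /= -!(entry_val d) eqT ?(valP x).
Qed.

Local Open Scope ring_scope.

Definition var_at n (i : nat) : {mpoly int[n]} := if insub i is Some o then 'X_(o : 'I_n) else 0.

Lemma var_at_ord n (o : 'I_n) : var_at n o = 'X_o.
Proof. by rewrite /var_at insubT //= => o_lt; congr ('X_ _); apply: val_inj. Qed.

Lemma prod_entries n d D (T : {ffun seq_sub D -> 'I_n}) : uniq D ->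
  \prod_x 'X_(T x) = \prod_(c <- D) var_at n (entry d T c) :> {mpoly int[n]}.
Proof.
move=> D_uniq; rewrite -(big_seq_sub _ (fun c => var_at n (entry d T c))) //; apply: eq_bigr => x _.
by rewrite entry_val var_at_ord.
Qed.

Section Branching.
Variables (n m : nat) (nu : seq nat).
Hypotheses (nu_part : is_partition nu) (ltmn : (m < n)%N).
Notation tableau nu := {ffun seq_sub (diagram nu [::]) -> 'I_n}.

Definition bounded_ssyt k nu (T : tableau nu) : bool := is_ssyt T && [forall x, (T x < k)%N].

Definition shape_below (T : tableau nu) : seq nat :=
  partition_of (fun i => count (fun j => entry m T (i.+1, j.+1) < m)%N (iota 0 (nth 0%N nu i)))
    (size nu).

Lemma shape_belowP T : bounded_ssyt m.+1 T ->
  [/\ is_partition (shape_below T), hstrip nu (shape_below T) &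
      {in diagram nu [::], forall c,
         (entry m T c < m)%N = (c \in diagram (shape_below T) [::])}].
Proof.
case/andP=> /(ssytP m)[rows cols] /(entry_ltP m) bound.
pose small i j := (entry m T (i.+1, j.+1) < m)%N.
pose f i := count (small i) (iota 0 (nth 0%N nu i)).
have smallE i j : (j < nth 0%N nu i)%N -> small i j = (j < f i)%N.
  apply: count_initial_segment => j1 j2 /andP[lt_j12 lt_j2]; apply: leq_ltn_trans.
  by apply: rows; rewrite ?mem_straight ?(ltn_trans lt_j12).
have f_le i : (f i <= nth 0%N nu i)%N by rewrite -[X in (_ <= X)%N](size_iota 0) count_size.
have f_ge i : (nth 0%N nu i.+1 <= f i)%N.
  rewrite leqNgt; apply/negP => lt_row1.
  have lt_row := leq_trans lt_row1 (partition_nthS i nu_part).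
  have /negP[] := ltnn (f i); rewrite -smallE //.
  have below_in : (i.+2, (f i).+1) \in diagram nu [::] by rewrite mem_straight.
  by rewrite /small -ltnS; apply: leq_trans (bound _ below_in); rewrite ltnS cols ?mem_straight.
have f_dec i : (f i.+1 <= f i)%N by apply: leq_trans (f_le _) (f_ge _).
have f0 : f (size nu) = 0%N by apply/eqP; rewrite -leqn0 -(nth_default 0%N (leqnn (size nu))) f_le.
have nth_sub i : nth 0%N (shape_below T) i = f i by apply: nth_partition_of.
split; first exact: is_partition_of.
  by apply/hstripP => i; rewrite nth_sub f_ge f_le.
move=> c c_nu; have [i [j cE]] := straight_cell c_nu; move: c_nu.
by rewrite cE !mem_straight nth_sub => /smallE.
Qed.

Section FixedShapeBelow.
Variable ka : seq nat.
Hypotheses (ka_part : is_partition ka) (strip : hstrip nu ka).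
Notation D := (diagram nu [::]).
Notation E := (diagram ka [::]).

Let sub_straight : {subset E <= D} := hstrip_straight_sub strip.

Lemma shape_below_eq T : bounded_ssyt m.+1 T ->
  shape_below T == ka <-> {in D, forall c, (entry m T c < m)%N = (c \in E)}.
Proof.
case/shape_belowP => sub_part sub_strip subE; split=> [/eqP <- //|kaE].
apply/eqP/eq_straight => // c; apply/idP/idP => c_in.
  have cD : c \in D := hstrip_straight_sub sub_strip c_in.
  by rewrite -kaE // subE.
by have cD := sub_straight c_in; rewrite -subE // kaE.
Qed.

(* [refit nu] extends a tableau by the entry [m], and [refit ka] restricts it. *)
Definition refit (nu1 nu2 : seq nat) (T : tableau nu1) : tableau nu2 :=
  [ffun x => if insub (val x) is Some y then T y else Ordinal ltmn].

Lemma entry_refit nu1 nu2 (T : tableau nu1) c :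
  c \in diagram nu2 [::] -> entry m (refit nu2 T) c = entry m T c.
Proof.
move=> c_in; rewrite -[c in LHS]/(val (SeqSub c_in)) entry_val ffunE /= /entry.
by case: insubP.
Qed.

Lemma bounded_ssyt_refit T : bounded_ssyt m T -> bounded_ssyt m.+1 (refit nu (T : tableau ka)).
Proof.
case/andP=> /(ssytP m)[rows cols] /(entry_ltP m) bound; apply/andP; split; last first.
  apply/(entry_ltP m) => c cD; rewrite entry_refit //.
  by case: (boolP (c \in E)) => [/bound/leqW|/entry_out ->].
have le_m c : (entry m T c <= m)%N.
  by case: (boolP (c \in E)) => [/bound/ltnW|/entry_out ->].
apply/(ssytP m); split=> [i j j' ij ij' ltjj'|i i' j ij i'j ltii']; rewrite !entry_refit //.
  case: (boolP ((i, j') \in E)) => [ij'E|/entry_out -> //]; apply: rows => //.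
  by move: ij' ij'E ij; rewrite !mem_diagram /part !nth_nil; lia.
have ijE : (i, j) \in E.
  have [i0 [j0 [iE jE]]] := straight_cell ij; have [i1 [j1 [i'E _]]] := straight_cell i'j.
  move: i'j ltii'; rewrite iE jE i'E !mem_straight ltnS => i'j ltii'.
  apply: leq_trans i'j (leq_trans _ (hstrip_nthS_le i0 strip)).
  exact: partition_nth_homo.
by case: (boolP ((i', j) \in E)) => [i'jE|/entry_out ->]; [exact: cols | exact: bound].
Qed.

Lemma shape_below_refit T : bounded_ssyt m T -> shape_below (refit nu (T : tableau ka)) == ka.
Proof.
move=> T_bd; have := T_bd; case/andP=> _ /(entry_ltP m) bound.
apply/shape_below_eq => [|c cD]; first exact: bounded_ssyt_refit.
by rewrite entry_refit //; case: (boolP (c \in E)) => [/bound|/entry_out ->]; rewrite ?ltnn.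
Qed.

Lemma refitK T : refit ka (refit nu (T : tableau ka)) = T.
Proof. by apply: (@entry_ext _ _ m) => c cE; rewrite !entry_refit ?sub_straight. Qed.

Lemma refit_restrictK T : bounded_ssyt m.+1 T -> shape_below T == ka -> refit nu (refit ka T) = T.
Proof.
move=> T_bd /(shape_below_eq T_bd) kaE; case/andP: T_bd => _ /(entry_ltP m) bound.
apply: (@entry_ext _ _ m) => c cD; rewrite entry_refit //.
case: (boolP (c \in E)) => cE; first by rewrite entry_refit.
rewrite entry_out //; apply/eqP; rewrite eqn_leq -[(_ <= m)%N]ltnS bound // andbT leqNgt.
by rewrite kaE.
Qed.

Lemma bounded_ssyt_restrict T :
  bounded_ssyt m.+1 T -> shape_below T == ka -> bounded_ssyt m (refit ka T).
Proof.
move=> T_bd /(shape_below_eq T_bd) kaE; case/andP: T_bd => /(ssytP m)[rows cols] _.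
apply/andP; split; last first.
  by apply/(entry_ltP m) => c cE; rewrite entry_refit // kaE // sub_straight.
apply/(ssytP m); split=> [i j j' ij ij' ltjj'|i i' j ij i'j ltii']; rewrite !entry_refit //.
  by apply: rows; rewrite ?sub_straight.
by apply: cols; rewrite ?sub_straight.
Qed.

Lemma prod_refit T :
  \prod_x 'X_((refit nu (T : tableau ka)) x) =
  var_at n m ^+ (sumn nu - sumn ka) * \prod_x 'X_(T x) :> {mpoly int[n]}.
Proof.
rewrite !(prod_entries m) ?diagram_uniq //.
have split_D : perm_eq D (E ++ [seq c <- D | c \notin E]).
  apply: uniq_perm; rewrite ?cat_uniq ?filter_uniq ?diagram_uniq //=.
    by rewrite andbT; apply/hasPn => c; rewrite mem_filter => /andP[].
  by move=> c; rewrite mem_cat mem_filter; case: (boolP (c \in E)) => //= /sub_straight.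
have size_rest : (sumn nu - sumn ka)%N = size [seq c <- D | c \notin E].
  by have := perm_size split_D; rewrite size_cat !size_straight => ->; rewrite addKn.
rewrite (perm_big _ split_D) big_cat /= mulrC; congr (_ * _); last first.
  by apply: eq_big_seq => c cE; rewrite entry_refit ?sub_straight.
rewrite size_rest (eq_big_seq (fun=> var_at n m)) => [|c].
  by rewrite big_const_seq count_predT iter_mulr_1.
by rewrite mem_filter => /andP[cE cD]; rewrite entry_refit // entry_out.
Qed.

Lemma sum_fixed_shape_below :
  \sum_(T : tableau nu | bounded_ssyt m.+1 T && (shape_below T == ka)) \prod_x 'X_(T x) =
  var_at n m ^+ (sumn nu - sumn ka) *
  \sum_(T : tableau ka | bounded_ssyt m T) \prod_x 'X_(T x) :> {mpoly int[n]}.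
Proof.
rewrite (reindex_onto (refit nu) (refit ka)) /= => [|T /andP[T_bd T_ka]]; last first.
  exact: refit_restrictK.
rewrite mulr_sumr; apply: eq_big => [T|T _]; last exact: prod_refit.
rewrite refitK eqxx andbT; apply/andP/idP => [[T_bd T_ka]|T_bd].
  by rewrite -[T]refitK bounded_ssyt_restrict.
by rewrite bounded_ssyt_refit ?shape_below_refit.
Qed.

End FixedShapeBelow.

Lemma schur_branching :
  \sum_(T : tableau nu | bounded_ssyt m.+1 T) \prod_x 'X_(T x) =
  \sum_(ka <- partitions_upto (sumn nu) | hstrip nu ka)
     var_at n m ^+ (sumn nu - sumn ka) *
     \sum_(T : tableau ka | bounded_ssyt m T) \prod_x 'X_(T x) :> {mpoly int[n]}.
Proof.
rewrite (partition_big_seq _ (s := partitions_upto (sumn nu)) (h := shape_below)) //; last first.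
- by move=> T /shape_belowP[sub_part strip _]; rewrite mem_partitions_upto sub_part hstrip_sumn.
- exact: partitions_upto_uniq.
rewrite [RHS]big_mkcond; apply: eq_big_seq => ka; rewrite mem_partitions_upto => /andP[ka_part _].
case: ifP => [strip|no_strip]; first exact: sum_fixed_shape_below.
rewrite big_pred0 // => T; apply/negP => /andP[/shape_belowP[_ strip _] /eqP T_ka].
by rewrite -T_ka strip in no_strip.
Qed.

End Branching.

Lemma bounded_ssyt0 n nu :
  is_partition nu ->
  \sum_(T : {ffun seq_sub (diagram nu [::]) -> 'I_n} | bounded_ssyt 0 T) \prod_x 'X_(T x) =
  (nu == [::])%:R :> {mpoly int[n]}.
Proof.
move=> nu_part; case: eqP => [->|nu_neq0].
  have no_cell (x : seq_sub (diagram [::] [::])) : False by have := valP x.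
  rewrite (big_pred1 [ffun x => False_rect _ (no_cell x)]) => [|T].
    by rewrite big1 // => x; case: (no_cell x).
  rewrite /= [RHS](_ : _ = true); last by apply/eqP/ffunP => x; case: (no_cell x).
  by apply/andP; split; [apply/(ssytP 0%N) | apply/forallP=> x; case: (no_cell x)].
rewrite big_pred0 // => T; apply/negP => /andP[_ /(entry_ltP 0%N)/(_ (1, 1)%N)].
by rewrite mem_straight partition_nth_gt0 // lt0n size_eq0 => /(_ (introN eqP nu_neq0)).
Qed.

Lemma sum_bounded_ssyt n m nu : (m <= n)%N -> is_partition nu ->
  \sum_(T : {ffun seq_sub (diagram nu [::]) -> 'I_n} | bounded_ssyt m T) \prod_x 'X_(T x) =
  schur_poly (var_at n) m nu.
Proof.
elim: m nu => [|m IHm] nu lemn nu_part; first exact: bounded_ssyt0.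
rewrite schur_branching //; apply: eq_big_seq_cond => ka.
by rewrite mem_partitions_upto => /andP[ka_part _] _; rewrite IHm // ltnW.
Qed.

Lemma schurE n nu : is_partition nu -> schur n nu = schur_poly (var_at n) n nu.
Proof.
move=> nu_part; rewrite -sum_bounded_ssyt //; apply: eq_bigl => T.
by rewrite /bounded_ssyt andb_idr // => _; apply/forallP.
Qed.

Local Close Scope ring_scope.

(** * Ribbon tableaux as words *)

Variant adjacency := Weak | Strict | Free.

Definition adjacent_ok k (a b : nat) : bool :=
  match k with Weak => b <= a | Strict => a < b | Free => true end.

Fixpoint satisfies (ks : seq adjacency) (w : seq nat) : bool :=
  if ks is k :: ks' then
    if w is a :: w' then
      (if w' is b :: _ then adjacent_ok k a b else true) && satisfies ks' w'
    else true
  else true.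

(* [(a, b) :: L] stands for a row of length [a] followed by the rows [L]; [b] tells
   whether this row overlaps the next one. *)
Local Notation flagged_rows := (seq (nat * bool)).

Definition junction (b : bool) : adjacency := if b then Strict else Free.

Fixpoint adjacencies (L : flagged_rows) : seq adjacency :=
  if L is (a, b) :: L' then
    nseq a.-1 Weak ++ (if L' is [::] then [::] else junction b :: adjacencies L')
  else [::].

Lemma adjacencies_cons a b L :
  0 < size L -> adjacencies ((a, b) :: L) = nseq a.-1 Weak ++ junction b :: adjacencies L.
Proof. by case: L. Qed.

Lemma satisfies_run m u : size u = m.+1 -> satisfies (nseq m Weak) u = sorted geq u.
Proof.
elim: m u => [|m IHm] [|a [|b u]] //= [size_u].
by rewrite IHm //= size_u.
Qed.

Lemma satisfies_run_cat m k ks u v : size u = m.+1 -> 0 < size v ->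
  satisfies (nseq m Weak ++ k :: ks) (u ++ v) =
  [&& sorted geq u, adjacent_ok k (last 0 u) (head 0 v) & satisfies ks v].
Proof.
elim: m u => [|m IHm] [|a [|b u]] //= size_u v_gt0; first by case: v v_gt0.
by rewrite (IHm (b :: u)) //=; [rewrite andbA | case: size_u => ->].
Qed.

Local Open Scope ring_scope.

Section Words.
Variables (R : comPzRingType) (x : nat -> R) (n : nat).

Fixpoint word_sum_from (ks : seq adjacency) (a : nat) : R :=
  if ks is k :: ks' then x a * \sum_(b < n | adjacent_ok k a b) word_sum_from ks' b else x a.

Definition word_sum ks : R := \sum_(a < n) word_sum_from ks a.

Lemma word_sum_from_split ks1 ks2 a :
  word_sum_from (ks1 ++ Free :: ks2) a =
  word_sum_from (ks1 ++ Weak :: ks2) a + word_sum_from (ks1 ++ Strict :: ks2) a.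
Proof.
elim: ks1 a => [|k ks1 IHks] a /=; last first.
  by rewrite -mulrDr -big_split /=; congr (_ * _); apply: eq_bigr => b _; apply: IHks.
rewrite -mulrDr (bigID (fun b : 'I_n => (b <= a)%N)) /=; congr (_ * (_ + _)).
by apply: eq_bigl => b; rewrite -ltnNge.
Qed.

Lemma word_sum_split ks1 ks2 :
  word_sum (ks1 ++ Free :: ks2) = word_sum (ks1 ++ Weak :: ks2) + word_sum (ks1 ++ Strict :: ks2).
Proof. by rewrite -big_split; apply: eq_bigr => a _; apply: word_sum_from_split. Qed.

Lemma word_sum_run_cat m ks :
  word_sum (nseq m Weak ++ Free :: ks) = word_sum (nseq m Weak) * word_sum ks.
Proof.
rewrite /word_sum mulr_suml; apply: eq_bigr => a _; elim: m (a : nat) => [|m IHm] {}a //=.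
by rewrite -mulrA mulr_suml; congr (_ * _); apply: eq_bigr => b _; apply: IHm.
Qed.

Lemma sum_complete_poly N m :
  \sum_(a < N) x a * complete_poly x a.+1 m = complete_poly x N m.+1.
Proof.
elim: N => [|N IHN]; first by rewrite big_ord0.
by rewrite big_ord_recr [in LHS]/= IHN complete_polyS.
Qed.

Lemma word_sum_from_run m (a : nat) :
  (a < n)%N -> word_sum_from (nseq m Weak) a = x a * complete_poly x a.+1 m.
Proof.
elim: m a => [|m IHm] a lta; first by rewrite complete_poly0 mulr1.
rewrite [LHS]/=; congr (_ * _); rewrite -sum_complete_poly.
rewrite (big_ord_widen_cond n (fun=> true) (fun b => x b * complete_poly x b.+1 m)) //.
by apply: eq_bigr => b _; apply: IHm.
Qed.

Lemma word_sum_run m : word_sum (nseq m Weak) = complete_poly x n m.+1.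
Proof. by rewrite -sum_complete_poly; apply: eq_bigr => a _; apply: word_sum_from_run. Qed.

Lemma word_sum_from_tuples ks a : word_sum_from ks a =
  \sum_(t : (size ks).-tuple 'I_n | satisfies ks (a :: map val t)) x a * \prod_(i <- t) x (val i).
Proof.
elim: ks a => [|k ks IHks] a /=.
  rewrite (big_pred1 [tuple]) => [|t]; first by rewrite big_nil mulr1.
  by rewrite [t]tuple0 /= eqxx.
rewrite big_tuple_cons mulr_sumr big_mkcond /=; apply: eq_bigr => b _.
case: ifP => ok_ab; last by rewrite big_pred0.
by rewrite IHks mulr_sumr /=; apply: eq_bigr => t _; rewrite big_cons.
Qed.

Lemma word_sum_tuples ks : word_sum ks =
  \sum_(t : (size ks).+1.-tuple 'I_n | satisfies ks (map val t)) \prod_(i <- t) x (val i).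
Proof.
rewrite big_tuple_cons; apply: eq_bigr => a _; rewrite word_sum_from_tuples.
by apply: eq_bigr => t _; rewrite /= big_cons.
Qed.

(* The empty ribbon has one tableau, whereas an empty list of adjacencies stands for
   the words with one letter. *)
Definition ribbon_sum (L : flagged_rows) : R :=
  if L is [::] then 1 else word_sum (adjacencies L).

Lemma ribbon_sumE L : (0 < size L)%N -> ribbon_sum L = word_sum (adjacencies L).
Proof. by case: L. Qed.

Lemma ribbon_sum_free_cons a L : (0 < a)%N ->
  ribbon_sum ((a, false) :: L) = complete_poly x n a * ribbon_sum L.
Proof.
move=> a_gt0; rewrite ribbon_sumE //; case: (posnP (size L)) => [/size0nil ->|L_gt0].
  by rewrite /= cats0 word_sum_run mulr1 prednK.
by rewrite adjacencies_cons // word_sum_run_cat word_sum_run prednK // ribbon_sumE.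
Qed.

Lemma adjacencies_junction L1 a a' b L : (0 < a)%N -> (0 < a')%N -> exists ks1 ks2,
  (forall e, adjacencies (L1 ++ (a, e) :: (a', b) :: L) = ks1 ++ junction e :: ks2) /\
  adjacencies (L1 ++ ((a + a')%N, b) :: L) = ks1 ++ Weak :: ks2.
Proof.
move=> a_gt0 a'_gt0; elim: L1 => [|[c d] L1 [ks1 [ks2 [ksE ks_weak]]]].
  exists (nseq a.-1 Weak), (adjacencies ((a', b) :: L)); split=> //=.
  have -> : ((a + a').-1 = a.-1 + (a'.-1).+1)%N by lia.
  by rewrite nseqD -catA.
exists (nseq c.-1 Weak ++ junction d :: ks1), ks2.
by split=> [e|]; rewrite cat_cons adjacencies_cons ?size_cat ?addnS // ?ksE ?ks_weak -catA.
Qed.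

(* The entries on both sides of a junction that carries no condition are either
   strictly increasing or weakly decreasing; in the latter case the rows merge. *)
Lemma ribbon_sum_merge L1 a a' b L : (0 < a)%N -> (0 < a')%N ->
  ribbon_sum (L1 ++ (a, false) :: (a', b) :: L) =
  ribbon_sum (L1 ++ ((a + a')%N, b) :: L) + ribbon_sum (L1 ++ (a, true) :: (a', b) :: L).
Proof.
move=> a_gt0 a'_gt0; have [ks1 [ks2 [ksE ks_weak]]] := adjacencies_junction L1 b L a_gt0 a'_gt0.
by rewrite !ribbon_sumE ?size_cat ?addnS // !ksE ks_weak word_sum_split.
Qed.

End Words.

Section Reading.
Variables (n : nat) (D E : seq (nat * nat)).
Hypotheses (E_uniq : uniq E) (eqDE : D =i E).

Lemma cell_of_rank_subproof (k : 'I_(size E)) : tnth (in_tuple E) k \in D.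
Proof. by rewrite eqDE mem_tnth. Qed.

Definition cell_of_rank (k : 'I_(size E)) : seq_sub D := SeqSub (cell_of_rank_subproof k).

Lemma cell_rank_subproof (y : seq_sub D) : (index (val y) E < size E)%N.
Proof. by rewrite index_mem -eqDE (valP y). Qed.

Definition cell_rank (y : seq_sub D) : 'I_(size E) := Ordinal (cell_rank_subproof y).

Lemma cell_of_rankK : cancel cell_of_rank cell_rank.
Proof. by move=> k; apply: val_inj; rewrite /= (tnth_nth (0, 0)%N) /= index_uniq. Qed.

Lemma cell_rankK : cancel cell_rank cell_of_rank.
Proof.
move=> y; apply: val_inj; rewrite /= (tnth_nth (0, 0)%N) /= nth_index // -eqDE.
exact: valP y.
Qed.

Definition reading_word (T : {ffun seq_sub D -> 'I_n}) : (size E).-tuple 'I_n :=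
  [tuple T (cell_of_rank k) | k < size E].

Lemma reading_word_bij : bijective reading_word.
Proof.
exists (fun t => [ffun y => tnth t (cell_rank y)]) => [T|t].
  by apply/ffunP => y; rewrite ffunE tnth_mktuple cell_rankK.
by apply: eq_from_tnth => k; rewrite tnth_mktuple ffunE cell_of_rankK.
Qed.

Lemma reading_word_entries d T : map val (reading_word T) = [seq entry d T c | c <- E].
Proof.
have E_enum : map (tnth (in_tuple E)) (enum 'I_(size E)) = E := map_tnth_enum (in_tuple E).
rewrite -[X in _ = map _ X]E_enum -!map_comp.
by apply: eq_map => k /=; rewrite -(entry_val d T).
Qed.

Lemma sum_reading_word d (P : pred {ffun seq_sub D -> 'I_n}) (Q : pred (seq nat)) :
  (forall T, P T = Q [seq entry d T c | c <- E]) ->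
  \sum_(T | P T) \prod_y 'X_(T y) =
  \sum_(t : (size E).-tuple 'I_n | Q (map val t)) \prod_(i <- t) var_at n (val i)
  :> {mpoly int[n]}.
Proof.
move=> PQ; rewrite [RHS](reindex reading_word) /=; last exact: onW_bij reading_word_bij.
apply: eq_big => [T|T _]; first by rewrite PQ -reading_word_entries.
rewrite (@big_tuple _ _ _ _ _ (reading_word T)) (reindex cell_of_rank) /=; last first.
  by exists cell_rank => y _; [apply: cell_of_rankK | apply: cell_rankK].
by apply: eq_bigr => k _; rewrite tnth_mktuple var_at_ord.
Qed.

End Reading.

Local Close Scope ring_scope.

(** * Tableaux of a ribbon with long rows *)

Lemma size_adjacencies (L : flagged_rows) : all (fun a => 0 < a) (unzip1 L) -> 0 < size L ->
  (size (adjacencies L)).+1 = sumn (unzip1 L).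
Proof.
elim: L => // -[a b] L IHL /andP[a_gt0 L_gt0] _; case: (posnP (size L)) => [/size0nil ->|size_gt0].
  by rewrite /= cats0 size_nseq addn0 prednK.
rewrite adjacencies_cons // size_cat size_nseq /= addnS -addSn prednK // -IHL //; lia.
Qed.

Section Ribbon.
Variables alpha lam mu : seq nat.
Hypotheses (ribbon : is_ribbon alpha lam mu) (alpha_ge2 : all (fun a => 2 <= a) alpha).
Notation l := (size lam).

Let lam_part : is_partition lam. Proof. by case: ribbon => -[]. Qed.
Let mu_part : is_partition mu. Proof. by case: ribbon => -[]. Qed.
Let alphaE : alpha = [seq part lam i - part mu i | i <- iota 1 l]. Proof. by case: ribbon. Qed.

Lemma ribbon_row_ge2 i : 1 <= i <= l -> part mu i + 2 <= part lam i.
Proof.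
move=> i_row; have : part lam i - part mu i \in alpha.
  by rewrite alphaE; apply: map_f; rewrite mem_iota; lia.
by move/(allP alpha_ge2) => /=; lia.
Qed.

Lemma ribbon_next_row_le i : 1 <= i -> part lam i.+1 <= (part mu i).+1.
Proof.
move=> i_gt0; rewrite leqNgt; apply/negP => lt_lam.
have lam_le := part_homo lam_part i_gt0 (leqnSn i).
have mu_le := part_homo mu_part i_gt0 (leqnSn i).
have [_ no_square _ _ _] := ribbon.
by apply: (no_square i (part mu i).+1); split; rewrite mem_diagram; lia.
Qed.

Definition overlap i : bool := part mu i < part lam i.+1.

Definition row_cells r := [seq (r, j) | j <- rev (iota (part mu r).+1 (part lam r - part mu r))].
Definition reading i k := flatten [seq row_cells r | r <- iota i k].
Definition rows i k : flagged_rows := [seq (part lam r - part mu r, overlap r) | r <- iota i k].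
Definition ribbon_rows : flagged_rows := rows 1 l.

Lemma size_ribbon_rows : size ribbon_rows = l.
Proof. by rewrite size_map size_iota. Qed.

Lemma unzip1_ribbon_rows : unzip1 ribbon_rows = alpha.
Proof. by rewrite alphaE /unzip1 -map_comp. Qed.

Lemma nth_ribbon_rows i :
  i < l -> nth (0, false) ribbon_rows i = (part lam i.+1 - part mu i.+1, overlap i.+1).
Proof. by move=> lt_i; rewrite (nth_map 0) ?size_iota // nth_iota. Qed.

Lemma last_ribbon_rows : ~~ (last (0, false) ribbon_rows).2.
Proof.
case: (posnP l) => [l0|l_gt0]; first by rewrite /ribbon_rows l0.
by rewrite -nth_last size_ribbon_rows nth_ribbon_rows ?prednK //= /overlap (@part_default lam).
Qed.

Lemma same_column r r' j :
  (r, j) \in diagram lam mu -> (r', j) \in diagram lam mu -> r < r' ->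
  [/\ r' = r.+1, j = (part mu r).+1, j = part lam r.+1 & overlap r].
Proof.
rewrite !mem_diagram => /andP[r_gt0 in_r] /andP[r'_gt0 in_r'] ltrr'.
have r'_le : r' <= l by rewrite leqNgt; apply/negP => /(part_default (s := lam)); lia.
have next := ribbon_next_row_le r_gt0; have next' := @ribbon_next_row_le r.+1 isT.
have row_ge2 := @ribbon_row_ge2 r.+1; have lam_r' := part_homo lam_part (isT : 0 < r.+1) ltrr'.
have r'E : r' = r.+1.
  apply/eqP; rewrite eqn_leq ltrr' andbT leqNgt; apply/negP => lt_r1r'.
  by have := part_homo lam_part (isT : 0 < r.+2) lt_r1r'; lia.
by move: in_r'; rewrite r'E /overlap => in_r'; split=> //; lia.
Qed.

Lemma mem_reading i k c :
  (c \in reading i k) = (i <= c.1 < i + k) && (part mu c.1 < c.2 <= part lam c.1).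
Proof.
apply/flatten_mapP/andP => [[r]|[in_rows in_row]].
  by rewrite mem_iota => r_in /mapP[j]; rewrite mem_rev mem_iota => j_in -> /=; lia.
exists c.1; rewrite ?mem_iota //; apply/mapP; exists c.2; last by case: (c).
by rewrite mem_rev mem_iota; lia.
Qed.

Lemma mem_diagram_reading : diagram lam mu =i reading 1 l.
Proof.
move=> [i j]; rewrite mem_diagram mem_reading /=.
apply/andP/andP => -[i_gt0 j_range]; split=> //; last by lia.
by rewrite i_gt0 add1n ltnS leqNgt; apply/negP => /(part_default (s := lam)); lia.
Qed.

Lemma reading_uniq i k : uniq (reading i k).
Proof.
elim: k i => [|k IHk] i //; rewrite /reading /= cat_uniq -/(reading i.+1 k) IHk andbT.
rewrite map_inj_uniq ?rev_uniq ?iota_uniq //=; last by move=> ? ? [].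
apply/hasPn => c; rewrite mem_reading => c_in; apply/negP => /mapP[j _ cE].
by move: c_in; rewrite cE /=; lia.
Qed.

Lemma size_reading i k : size (reading i k) = sumn (unzip1 (rows i k)).
Proof.
rewrite size_flatten /shape /unzip1 -!map_comp; congr sumn; apply: eq_map => r /=.
by rewrite size_map size_rev size_iota.
Qed.

Lemma row_wordP (g : nat * nat -> nat) r :
  reflect (forall j j', part mu r < j -> j < j' -> j' <= part lam r -> g (r, j) <= g (r, j'))
          (sorted geq (map g (row_cells r))).
Proof.
rewrite /row_cells -map_comp map_rev rev_sorted; set s := map _ _.
have leq_tr : transitive (fun y x : nat => x >= y) by move=> a b c; apply: leq_trans.
have size_s : size s = part lam r - part mu r by rewrite size_map size_iota.
have nth_s k : k < part lam r - part mu r -> nth 0 s k = g (r, (part mu r).+1 + k).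
  by move=> lt_k; rewrite (nth_map 0) ?size_iota // nth_iota.
apply: (iffP idP) => [s_sorted j j' gt_mu ltjj' le_lam|g_incr].
  have := sorted_ltn_nth leq_tr 0 s_sorted (j - (part mu r).+1) (j' - (part mu r).+1).
  by rewrite !inE size_s !nth_s ?subnKC; try lia; apply; lia.
by apply/(sortedP 0) => k; rewrite size_s => lt_k; rewrite !nth_s; try lia; apply: g_incr; lia.
Qed.

Section RowWord.
Variables (g : nat * nat -> nat) (r : nat).
Hypothesis r_row : 1 <= r <= l.

Lemma size_row_word : size (map g (row_cells r)) = (part lam r - part mu r).-1.+1.
Proof. by rewrite !size_map size_rev size_iota; have := ribbon_row_ge2 r_row; lia. Qed.

Lemma last_row_word : last 0 (map g (row_cells r)) = g (r, (part mu r).+1).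
Proof.
rewrite /row_cells; have -> : part lam r - part mu r = (part lam r - part mu r).-1.+1.
  by have := ribbon_row_ge2 r_row; lia.
by rewrite /= rev_cons !map_rcons last_rcons.
Qed.

Lemma head_row_word v : head 0 (map g (row_cells r) ++ v) = g (r, part lam r).
Proof.
have row_ge2 := ribbon_row_ge2 r_row; rewrite /row_cells.
have -> : part lam r - part mu r = (part lam r - part mu r).-1 + 1 by lia.
by rewrite iotaD rev_cat /=; congr (g (_, _)); lia.
Qed.

End RowWord.

Lemma satisfies_reading_cons g i k : 1 <= i -> i + k.+2 <= l.+1 ->
  satisfies (adjacencies (rows i k.+2)) (map g (reading i k.+2)) =
  [&& sorted geq (map g (row_cells i)),
      overlap i ==> (g (i, (part mu i).+1) < g (i.+1, part lam i.+1)) &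
      satisfies (adjacencies (rows i.+1 k.+1)) (map g (reading i.+1 k.+1))].
Proof.
move=> i_gt0 ik_le; have row_i : 1 <= i <= l by lia.
have row_i1 : 1 <= i.+1 <= l by lia.
have word_gt0 : 0 < size (map g (reading i.+1 k.+1)).
  by rewrite /reading /= map_cat size_cat size_row_word.
rewrite adjacencies_cons // -/(rows i.+1 k.+1) [reading i _]/= map_cat -/(reading i.+1 k.+1).
rewrite satisfies_run_cat ?size_row_word // last_row_word //.
rewrite [X in head 0 X]map_cat head_row_word //.
by rewrite /junction; case: (overlap i).
Qed.

Lemma satisfies_readingP g i k : 1 <= i -> i + k <= l.+1 ->
  reflect ((forall r, i <= r < i + k -> sorted geq (map g (row_cells r))) /\
           (forall r, i <= r -> r.+1 < i + k -> overlap r ->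
              g (r, (part mu r).+1) < g (r.+1, part lam r.+1)))
          (satisfies (adjacencies (rows i k)) (map g (reading i k))).
Proof.
elim: k i => [|[|k] IHk] i i_gt0 ik_le; first by left; split=> r; lia.
  have row_i : 1 <= i <= l by lia.
  rewrite /rows /reading /= !cats0 satisfies_run ?size_row_word //.
  apply: (iffP idP) => [row_sorted|[row_sorted _]]; last by apply: row_sorted; lia.
  by split=> r; [move=> r_in; have -> : r = i by lia | lia].
rewrite satisfies_reading_cons //; apply: (iffP and3P).
  move=> [row_i overlap_i /(IHk i.+1 isT ltac:(lia))[row_sorted overlaps]].
  split=> r r_in; case: (eqVneq r i) => [->|r_neq] //; first by apply: row_sorted; lia.
    by move=> _; apply/implyP.
  by move=> r_lt; apply: overlaps; lia.
move=> [row_sorted overlaps]; split; first by apply: row_sorted; lia.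
  by apply/implyP; apply: overlaps; lia.
apply/(IHk i.+1 isT ltac:(lia)).
by split=> r r_in; [apply: row_sorted; lia | move=> r_lt; apply: overlaps; lia].
Qed.

Lemma ssyt_reading n (T : {ffun seq_sub (diagram lam mu) -> 'I_n}) :
  is_ssyt T = satisfies (adjacencies ribbon_rows) [seq entry 0 T c | c <- reading 1 l].
Proof.
apply/(ssytP 0)/(satisfies_readingP _ (leqnn 1) (leqnn _)) => -[rows_ok cols_ok].
  split=> [r r_in|r r_gt0 r_lt ov].
    by apply/row_wordP => j j' gt_mu ltjj' le_lam; apply: rows_ok; rewrite ?mem_diagram; lia.
  have next := ribbon_next_row_le r_gt0; have row_r := @ribbon_row_ge2 r.
  have row_r1 := @ribbon_row_ge2 r.+1; move: ov; rewrite /overlap => ov.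
  have <- : (part mu r).+1 = part lam r.+1 by lia.
  by apply: cols_ok; rewrite ?mem_diagram; lia.
split=> [i j j' ij ij' ltjj'|i i' j ij i'j ltii'].
  have := ij; have := ij'; rewrite !mem_diagram_reading !mem_reading /= => in_i' in_i.
  by apply: (row_wordP _ _ (rows_ok i _)) => //; lia.
have [i'E jE jE' ov] := same_column ij i'j ltii'; move: i'j; rewrite i'E => i1j.
rewrite {1}jE jE'; apply: cols_ok => //.
  by move: ij; rewrite mem_diagram => /andP[].
by move: i1j; rewrite mem_diagram_reading mem_reading => /andP[/andP[]].
Qed.

Lemma ribbon_schurE n : skew_schur n lam mu = ribbon_sum (var_at n) n ribbon_rows.
Proof.
have := sum_reading_word (reading_uniq 1 l) mem_diagram_reading (@ssyt_reading n).
rewrite /skew_schur => ->; case: (posnP (size ribbon_rows)) => [/size0nil rows0|rows_gt0].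
  have l0 : l = 0 by rewrite -size_ribbon_rows rows0.
  rewrite rows0 /= l0 (big_pred1 [tuple]) ?big_nil // => t.
  by rewrite [t]tuple0; apply/esym/eqP.
rewrite ribbon_sumE // word_sum_tuples size_adjacencies // -?size_reading //.
by rewrite unzip1_ribbon_rows; apply: sub_all alpha_ge2 => a; apply: ltnW.
Qed.

Lemma column_length_fromS i j :
  column_length_from lam mu i j = ((i, j) \in diagram lam mu) + column_length_from lam mu i.+1 j.
Proof.
rewrite /column_length_from -(count_uniq_mem (i, j) (diagram_uniq lam mu)) -count_predUI.
rewrite [X in _ = _ + X](eq_count (a2 := pred0)) ?count_pred0 ?addn0.
  by apply: eq_count => -[a b] /=; rewrite xpair_eqE; lia.
by move=> [a b] /=; rewrite xpair_eqE; lia.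
Qed.

Lemma column_length_from_eq0 i j :
  (forall r, i <= r -> (r, j) \notin diagram lam mu) -> column_length_from lam mu i j = 0.
Proof.
move=> no_cell; apply/eqP; rewrite -leqn0 leqNgt -has_count; apply/hasPn => -[r j'] in_D /=.
by apply/negP => /andP[/no_cell + /eqP jE]; rewrite -jE in_D.
Qed.

Lemma column_length_below i j : (i, j) \in diagram lam mu ->
  column_length_from lam mu i.+1 j = (j == (part mu i).+1) && overlap i.
Proof.
move=> ij; rewrite column_length_fromS column_length_from_eq0 ?addn0 => [|r gt_r].
  congr nat_of_bool; apply/idP/andP => [i1j|[/eqP jE ov]].
    by have [_ /eqP jE _ ov] := same_column ij i1j (ltnSn i).
  have i_gt0 : 0 < i by move: ij; rewrite mem_diagram => /andP[].
  have := ribbon_next_row_le i_gt0; have := part_homo mu_part i_gt0 (leqnSn i).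
  have := @ribbon_row_ge2 i.+1; have := @part_default lam i.+1.
  by move: ov; rewrite mem_diagram jE /overlap; lia.
by apply/negP => rj; have [rE _ _ _] := same_column ij rj (ltnW gt_r); move: gt_r; rewrite rE ltnn.
Qed.

Lemma count_long_columnsS i : 1 <= i <= l ->
  count (fun j => column_length_from lam mu i j == 2) (iota 1 (part lam 1)) =
  overlap i + count (fun j => column_length_from lam mu i.+1 j == 2) (iota 1 (part lam 1)).
Proof.
move=> row_i; have row_ge2 := ribbon_row_ge2 row_i; have i_gt0 : 0 < i by lia.
have lam_le := part_homo lam_part (leqnn 1) i_gt0.
have countE (P : pred nat) s : count P s = \sum_(j <- s) P j by rewrite -sum1_count big_mkcond.
have -> : nat_of_bool (overlap i) =
    count (fun j => (j == (part mu i).+1) && overlap i) (iota 1 (part lam 1)).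
  case: (overlap i); last by rewrite (eq_count (a2 := pred0)) ?count_pred0 // => j; rewrite andbF.
  rewrite (eq_count (a2 := pred1 (part mu i).+1)) => [|j]; last by rewrite andbT.
  by rewrite count_uniq_mem ?iota_uniq // mem_iota; lia.
rewrite !countE -big_split; apply: eq_bigr => j _ /=; rewrite column_length_fromS.
case: (boolP ((i, j) \in diagram lam mu)) => ij; last first.
  by case: (eqVneq j (part mu i).+1) ij => //= ->; rewrite mem_diagram; lia.
by rewrite column_length_below //; case: (_ && _).
Qed.

Lemma nth_overlapping_partition i :
  nth 0 (overlapping_partition lam mu) i = count snd (drop i ribbon_rows).
Proof.
case: (leqP l i) => [ge_l|lt_l].
  by rewrite nth_default ?drop_oversize ?size_ribbon_rows ?size_map ?size_iota.
rewrite (nth_map 0) ?size_iota // nth_iota // add1n.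
have [k] := ubnP (l - i); elim: k i lt_l => // k IHk i lt_l le_k.
rewrite count_long_columnsS // (drop_nth (0, false)) ?size_ribbon_rows // nth_ribbon_rows //=.
congr (_ + _); case: (ltnP i.+1 l) => [lt_l1|ge_l1]; first by apply: IHk => //; lia.
rewrite drop_oversize ?size_ribbon_rows // (eq_count (a2 := pred0)) ?count_pred0 // => j.
rewrite column_length_from_eq0 // => r gt_r; rewrite mem_diagram (@part_default lam); last by lia.
by rewrite andbC; case: ltnP => //; lia.
Qed.

End Ribbon.

(** * Chains of horizontal strips *)

(* The chains from [nu] down to the empty partition that remove strips of the sizes
   in [L] with descents at its flags; [b] asks for a descent between the first
   strip and [rho / nu]. *)
Fixpoint chain_count (L : flagged_rows) (b : bool) (rho nu : seq nat) : nat :=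
  if L is (a, b') :: L' then
    \sum_(ka <- strip_removals a nu | b ==> descent ka nu rho) chain_count L' b' nu ka
  else nu == [::].

Lemma chain_count_false L rho rho' nu : chain_count L false rho nu = chain_count L false rho' nu.
Proof. by case: L => [|[a b] L]. Qed.

Lemma not_descent ka nu rho i j :
  ~~ descent ka nu rho -> i < j -> nth 0 ka i < nth 0 nu i -> nth 0 rho j <= nth 0 nu j.
Proof.
move=> no_desc ltij lti; rewrite leqNgt; apply: contra no_desc => ltj.
by apply/descentP; exists i, j.
Qed.

Lemma descent_merge_below nu2 nu1 nu rho :
  hstrip nu nu1 -> hstrip nu1 nu2 -> ~~ descent nu2 nu1 nu -> sumn nu1 < sumn nu ->
  descent nu1 nu rho = descent nu2 nu rho.
Proof.
move=> /hstripP strip1 /hstripP strip2 no_desc /exists_nth_lt[k ltk].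
apply/descentP/descentP => -[i [j [ltij lti ltj]]].
  by exists i, j; split=> //; have := strip2 i; lia.
case: (ltnP (nth 0 nu1 i) (nth 0 nu i)) => [lt_nu|ge_nu]; first by exists i, j.
exists k, j; split=> //; apply: leq_ltn_trans ltij; rewrite leqNgt; apply/negP => ltik.
by have := not_descent no_desc ltik; lia.
Qed.

Lemma descent_merge_above nu3 nu2 nu1 nu :
  hstrip nu nu1 -> hstrip nu1 nu2 -> ~~ descent nu2 nu1 nu -> sumn nu2 < sumn nu1 ->
  descent nu3 nu2 nu1 = descent nu3 nu2 nu.
Proof.
move=> /hstripP strip1 /hstripP strip2 no_desc /exists_nth_lt[k ltk].
apply/descentP/descentP => -[i [j [ltij lti ltj]]].
  by exists i, j; split=> //; have := strip1 j; lia.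
case: (ltnP (nth 0 nu2 j) (nth 0 nu1 j)) => [lt_nu1|ge_nu1]; first by exists i, j.
exists i, k; split=> //; apply: leq_trans ltij _; rewrite leqNgt; apply/negP => ltkj.
by have := not_descent no_desc ltkj ltk; lia.
Qed.

(* A horizontal strip splits uniquely into two consecutive strips of given sizes
   without a descent: the outer one consists of its first [a] cells from the top. *)
Section StripSplitting.
Variables (nu nu2 : seq nat) (a a' : nat).
Hypothesis nu_sum : sumn nu = sumn nu2 + a' + a.
Let d i := nth 0 nu i - nth 0 nu2 i.

Definition splits nu1 := [&& hstrip nu nu1, hstrip nu1 nu2 & ~~ descent nu2 nu1 nu].

Lemma splits_hstrip nu1 : splits nu1 -> hstrip nu nu2.
Proof.
case/and3P=> /hstripP strip1 /hstripP strip2 no_desc; apply/hstripP => i.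
have := strip1 i; have := strip2 i; have := strip1 i.+1; have := not_descent no_desc (leqnn i.+1).
by case: (ltnP (nth 0 nu2 i) (nth 0 nu1 i)) => [_ /(_ isT)|]; lia.
Qed.

Lemma splits_prefix nu1 k : sumn nu1 = sumn nu2 + a' -> splits nu1 ->
  \sum_(i < k) (nth 0 nu i - nth 0 nu1 i) = minn a (\sum_(i < k) d i).
Proof.
move=> nu1_sum /and3P[/hstripP strip1 /hstripP strip2 no_desc].
pose e i := nth 0 nu i - nth 0 nu1 i; set K := k + size nu + size nu1.
rewrite -[LHS]/(\sum_(i < k) e i).
have sum_e : \sum_(i < K) e i = a.
  rewrite sumnB => [|i _]; last by case/andP: (strip1 i).
  by rewrite !sum_nth ?nu_sum ?nu1_sum /K; lia.
have le_a : \sum_(i < k) e i <= a by rewrite -sum_e leq_sum_prefix // /K; lia.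
have le_d : \sum_(i < k) e i <= \sum_(i < k) d i.
  by apply: leq_sum => i _; rewrite /e /d; have := strip2 i; lia.
case: (boolP [exists i : 'I_k, nth 0 nu2 i < nth 0 nu1 i]) => [/existsP[i lti]|/existsPn full].
  suff : \sum_(i < k) e i = a by lia.
  rewrite -sum_e (@big_ord_widen _ _ _ k K e) /K; last by lia.
  rewrite big_mkcond; apply: eq_bigr => j _; case: ltnP => // lekj.
  by rewrite /e; have := not_descent no_desc (leq_trans (ltn_ord i) lekj) lti; lia.
suff : \sum_(i < k) e i = \sum_(i < k) d i by lia.
by apply: eq_bigr => i _; rewrite /e /d; have := full i; have := strip2 i; rewrite -leqNgt; lia.
Qed.

Definition split_row i := nth 0 nu i - greedy_fill d a i.

Lemma splits_exists : hstrip nu nu2 ->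
  exists nu1, [/\ is_partition nu1, sumn nu1 = sumn nu2 + a' & splits nu1].
Proof.
move/hstripP=> strip; set K := size nu + size nu2.
have le_d i : greedy_fill d a i <= d i := leq_greedy_fill d a i.
have d_eq i : d i + nth 0 nu2 i = nth 0 nu i by rewrite /d; have := strip i; lia.
have row_dec i : split_row i.+1 <= split_row i.
  by rewrite /split_row; have := le_d i; have := strip i; have := d_eq i; lia.
have rowK : split_row K = 0 by rewrite /split_row nth_default // /K leq_addr.
have nth_nu1 := nth_partition_of row_dec rowK.
exists (partition_of split_row K); split; first exact: is_partition_of.
  rewrite sumn_partition_of // sumnB => [|i _]; last by have := le_d i; have := d_eq i; lia.
  rewrite sum_greedy_fill sumnB => [|i _]; last by have := strip i; lia.
  by rewrite !sum_nth ?nu_sum /K ?leq_addr ?leq_addl //; lia.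
apply/and3P; split.
- apply/hstripP => i; rewrite nth_nu1 /split_row.
  by have := le_d i; have := d_eq i; have := strip i; lia.
- apply/hstripP => i; rewrite !nth_nu1 /split_row.
  have := le_d i; have := d_eq i; have := strip i.
  by have := le_d i.+1; have := d_eq i.+1; lia.
apply/descentP => -[i [j [ltij]]]; rewrite !nth_nu1 /split_row => lti ltj.
have not_full : greedy_fill d a i < d i by have := d_eq i; lia.
have := @leq_sum_prefix d i.+1 j ltij; rewrite big_ord_recr /=.
move: not_full ltj; rewrite /greedy_fill; clear.
by move: (\sum_(k < i) d k) (\sum_(k < j) d k) => s1 s2; lia.
Qed.

Lemma count_splits : count splits (partitions (sumn nu2 + a')) = hstrip nu nu2.
Proof.
case: (boolP (hstrip nu nu2)) => [|no_strip]; last first.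
  rewrite (eq_count (a2 := pred0)) ?count_pred0 // => nu1; apply/negbTE.
  exact: contra (@splits_hstrip nu1) no_strip.
case/splits_exists=> w [w_part w_sum w_splits].
rewrite (eq_in_count (a2 := pred1 w)) => [|nu1]; last first.
  rewrite mem_partitions => /andP[nu1_part /eqP nu1_sum].
  apply/idP/eqP => [nu1_splits|->] //; apply: eq_partition => // i.
  have := splits_prefix i.+1 nu1_sum nu1_splits; have := splits_prefix i nu1_sum nu1_splits.
  rewrite -(splits_prefix i.+1 w_sum w_splits) -(splits_prefix i w_sum w_splits) !big_ord_recr /=.
  case/and3P: nu1_splits => /(hstrip_nth_le i) + _ _.
  by case/and3P: w_splits => /(hstrip_nth_le i) + _ _; lia.
by rewrite count_uniq_mem ?partitions_uniq // mem_partitions w_part w_sum eqxx.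
Qed.

End StripSplitting.

Lemma sum_strip_pairs a a' nu (F : seq nat -> nat) :
  \sum_(nu1 <- strip_removals a nu)
     \sum_(nu2 <- strip_removals a' nu1 | ~~ descent nu2 nu1 nu) F nu2 =
  \sum_(nu2 <- strip_removals (a + a') nu) F nu2.
Proof.
case: (leqP (a + a') (sumn nu)) => [le_sum|gt_sum]; last first.
  rewrite [RHS]big_seq [RHS]big_pred0 => [|nu2]; last first.
    by apply/negP => /strip_removalsP[_ nu_sum _]; lia.
  rewrite big1_seq // => nu1 /strip_removalsP[_ nu_sum _].
  rewrite big_seq_cond big_pred0 // => nu2; apply/negP => /andP[/strip_removalsP[_ nu1_sum _] _].
  by lia.
have lea : a <= sumn nu by lia.
transitivity (\sum_(nu1 <- partitions (sumn nu - a))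
    \sum_(nu2 <- partitions (sumn nu - (a + a')) | splits nu nu2 nu1) F nu2).
  rewrite big_filter big_mkcond; apply: eq_big_seq => nu1; rewrite lea mem_partitions /=.
  case/andP=> nu1_part /eqP nu1_sum; rewrite /splits.
  case: (hstrip nu nu1); last by rewrite big_pred0.
  rewrite big_filter_cond nu1_sum subnDA; apply: eq_bigl => nu2 /=.
  by rewrite (_ : a' <= sumn nu - a); lia.
rewrite (exchange_big_dep predT) //= [RHS]big_filter [RHS]big_mkcond /= le_sum.
apply: eq_big_seq => nu2; rewrite mem_partitions => /andP[nu2_part /eqP nu2_sum].
have nu_sum : sumn nu = sumn nu2 + a' + a by lia.
rewrite big_const_seq iter_addn_0 (_ : sumn nu - a = sumn nu2 + a'); last by lia.
by rewrite (count_splits nu_sum); case: hstrip; rewrite ?muln1 ?muln0.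
Qed.

Lemma chain_count_merge a a' b L c rho nu : 0 < a -> 0 < a' ->
  chain_count ((a, false) :: (a', b) :: L) c rho nu =
  chain_count ((a + a', b) :: L) c rho nu + chain_count ((a, true) :: (a', b) :: L) c rho nu.
Proof.
move=> a_gt0 a'_gt0 /=.
transitivity (\sum_(nu1 <- strip_removals a nu | c ==> descent nu1 nu rho)
    (\sum_(nu2 <- strip_removals a' nu1 | ~~ descent nu2 nu1 nu) chain_count L b nu1 nu2 +
     \sum_(nu2 <- strip_removals a' nu1 | descent nu2 nu1 nu) chain_count L b nu1 nu2)).
  by apply: eq_bigr => nu1 _; rewrite [LHS](bigID (fun nu2 => ~~ descent nu2 nu1 nu)) /=;
    congr (_ + _); apply: eq_bigl => nu2; rewrite negbK.
rewrite big_split /=; congr (_ + _).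
rewrite [RHS]big_mkcond -sum_strip_pairs big_mkcond /=.
apply: eq_big_seq => nu1 /strip_removalsP[_ nu_sum strip1].
transitivity (\sum_(nu2 <- strip_removals a' nu1 | ~~ descent nu2 nu1 nu)
    if c ==> descent nu1 nu rho then chain_count L b nu1 nu2 else 0).
  by case: ifP => // _; rewrite big1.
apply: eq_big_seq_cond => nu2 /strip_removalsP[_ nu1_sum strip2] no_desc.
rewrite (descent_merge_below _ strip1 strip2 no_desc); last by lia.
case: ifP => // _; case: L => [|[a3 b3] L] //=; apply: eq_bigl => nu3.
by rewrite (descent_merge_above _ strip1 strip2 no_desc) //; lia.
Qed.

Lemma chain_count_merge_cat L1 a a' b L c rho nu : 0 < a -> 0 < a' ->
  chain_count (L1 ++ (a, false) :: (a', b) :: L) c rho nu =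
  chain_count (L1 ++ (a + a', b) :: L) c rho nu +
  chain_count (L1 ++ (a, true) :: (a', b) :: L) c rho nu.
Proof.
move=> a_gt0 a'_gt0; elim: L1 c rho nu => [|[a1 b1] L1 IHL1] c rho nu.
  exact: chain_count_merge.
by rewrite /= -big_split /=; apply: eq_bigr => nu1 _; apply: IHL1.
Qed.

(** * The Schur expansion of a ribbon *)

Local Open Scope ring_scope.

Section Expansion.
Variables (R : comPzRingType) (x : nat -> R) (n : nat).

Definition chain_expansion (L : flagged_rows) : R :=
  \sum_(nu <- partitions (sumn (unzip1 L))) (chain_count L false [::] nu)%:R * schur_poly x n nu.

Lemma chain_expansion_nil : chain_expansion [::] = 1.
Proof. by rewrite /chain_expansion (perm_big _ perm_partitions0) big_seq1 schur_poly_nil mulr1. Qed.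

Lemma chain_expansion_free_cons a L :
  chain_expansion ((a, false) :: L) = complete_poly x n a * chain_expansion L.
Proof.
rewrite mulr_sumr; set N := sumn (unzip1 L).
transitivity (\sum_(ka <- partitions N) \sum_(nu <- partitions (N + a) | hstrip nu ka)
    (chain_count L false [::] ka)%:R * schur_poly x n nu); last first.
  apply: eq_big_seq => ka; rewrite mem_partitions => /andP[ka_part /eqP ka_sum].
  by rewrite mulrCA pieri // ka_sum mulr_sumr.
rewrite (exchange_big_dep predT) //= /chain_expansion /= [(a + _)%N]addnC.
apply: eq_big_seq => nu; rewrite mem_partitions => /andP[_ /eqP nu_sum].
rewrite -mulr_suml natr_sum big_filter nu_sum addnK; congr (_ * _).
apply: eq_big => [ka|ka _]; first by rewrite leq_addl.
by rewrite (chain_count_false _ nu [::]).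
Qed.

Lemma chain_expansion_merge L1 a a' b L : (0 < a)%N -> (0 < a')%N ->
  chain_expansion (L1 ++ (a, false) :: (a', b) :: L) =
  chain_expansion (L1 ++ ((a + a')%N, b) :: L) +
  chain_expansion (L1 ++ (a, true) :: (a', b) :: L).
Proof.
move=> a_gt0 a'_gt0; rewrite /chain_expansion /unzip1 !map_cat /= !sumn_cat /= !addnA -big_split.
by apply: eq_bigr => nu _; rewrite chain_count_merge_cat // natrD mulrDl.
Qed.

Lemma ribbon_sum_free L : all (fun a => 0 < a)%N (unzip1 L) -> ~~ has snd L ->
  ribbon_sum x n L = chain_expansion L.
Proof.
elim: L => [|[a b] L IHL]; first by rewrite chain_expansion_nil.
case/andP=> a_gt0 L_gt0; rewrite [has _ _]/= negb_or => /andP[/negbTE -> L_free].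
by rewrite ribbon_sum_free_cons // IHL // chain_expansion_free_cons.
Qed.

Lemma flagged_split (L : flagged_rows) : has snd L -> exists L1 a L2, L = L1 ++ (a, true) :: L2.
Proof.
elim: L => //= -[a [|]] L IHL /=; first by exists [::], a, L.
by case/IHL => L1 [a' [L2 ->]]; exists ((a, false) :: L1), a', L2.
Qed.

(* Induction on the number of overlaps: both sides satisfy the merging relation. *)
Lemma ribbon_sum_expansion L :
  all (fun a => 0 < a)%N (unzip1 L) -> ~~ (last (0%N, false) L).2 ->
  ribbon_sum x n L = chain_expansion L.
Proof.
have [k] := ubnP (count snd L); elim: k L => // k IHk L; rewrite ltnS => le_k.
case: (boolP (has snd L)) le_k => [/flagged_split[L1 [a [[|[a' b] L2] ->]]]|L_free _ L_gt0 _].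
- by rewrite last_cat.
- rewrite count_cat /= => le_k; rewrite /unzip1 map_cat all_cat last_cat.
  move=> /and4P[L1_gt0 a_gt0 a'_gt0 L2_gt0] last_free.
  have free := IHk (L1 ++ (a, false) :: (a', b) :: L2).
  have merged := IHk (L1 ++ ((a + a')%N, b) :: L2).
  apply: (addrI (ribbon_sum x n (L1 ++ ((a + a')%N, b) :: L2))).
  rewrite -ribbon_sum_merge // free ?merged ?chain_expansion_merge //.
  + by rewrite count_cat /=; lia.
  + by rewrite /unzip1 map_cat all_cat /= addn_gt0 a_gt0 L1_gt0.
  + by rewrite last_cat; case: (L2) last_free.
  + by rewrite count_cat /=; lia.
  + by rewrite /unzip1 map_cat all_cat /= L1_gt0 a_gt0 a'_gt0.
  + by rewrite last_cat.
- exact: ribbon_sum_free.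
Qed.

End Expansion.

Local Close Scope ring_scope.

(** * Linear independence of Schur polynomials *)

Lemma count_rows_straight nu j : count (fun c => c.1 <= j) (diagram nu [::]) = sumn (take j nu).
Proof.
rewrite -size_straight -size_filter; apply/perm_size/uniq_perm.
- by rewrite filter_uniq ?diagram_uniq.
- exact: diagram_uniq.
case=> a b; rewrite mem_filter !mem_diagram /part !nth_nil /=.
case: a => [|a] /=; first by rewrite ?andbF.
case: (ltnP a j) => [ltaj|leja]; first by rewrite nth_take.
have take_le : size (take j nu) <= a by rewrite size_take; case: ifP; lia.
by rewrite (nth_default 0 take_le) /=; case: b.
Qed.

Lemma count_row_straight nu i : count (fun c => c.1 == i.+1) (diagram nu [::]) = nth 0 nu i.
Proof.
have := sumn_takeS nu i; rewrite -!count_rows_straight.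
have -> D : count (fun c => c.1 <= i.+1) D =
    count (fun c => c.1 <= i) D + count (fun c => c.1 == i.+1) D.
  by elim: D => //= c D ->; lia.
exact: addnI.
Qed.

Section Content.
Variables (n : nat) (nu : seq nat).
Hypothesis nu_part : is_partition nu.
Notation D := (diagram nu [::]).
Implicit Types (T : {ffun seq_sub D -> 'I_n}) (ka : seq nat).

Definition content T : 'X_{1..n} := (\sum_x U_(T x))%MM.
Definition shape_monomial ka : 'X_{1..n} := [multinom nth 0 ka i | i < n].

Lemma contentE T i : content T i = #|[pred x | T x == i]|.
Proof.
rewrite mnm_sumE -sum1_card [RHS]big_mkcond; apply: eq_bigr => x _.
by rewrite mnmE inE; case: eqP.
Qed.

Lemma mcoeff_schur ka :
  ((schur n nu)@_(shape_monomial ka) =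
   #|[pred T | is_ssyt T & content T == shape_monomial ka]|%:R)%R.
Proof.
rewrite /schur /skew_schur raddf_sum -sum1_card natr_sum /= [RHS]big_mkcondr /=.
by apply: eq_bigr => T _; rewrite mprodXE mcoeffX; case: eqP.
Qed.

Lemma ssyt_entry_ge_row T i j :
  is_ssyt T -> (i.+1, j.+1) \in D -> i <= entry 0 T (i.+1, j.+1).
Proof.
case/(ssytP 0)=> _ cols; elim: i => // i IHi in_D.
have above : (i.+1, j.+1) \in D.
  by move: in_D; rewrite !mem_straight => /leq_trans; apply; apply: partition_nthS.
by apply: leq_ltn_trans (IHi above) _; apply: cols.
Qed.

Lemma content_prefix T j : \sum_(i < n | i < j) content T i = #|[pred x | T x < j]|.
Proof.
rewrite -sum1_card (partition_big (fun x => T x) (fun i : 'I_n => i < j)) //=.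
apply: eq_bigr => i ltij; rewrite contentE -sum1_card; apply: eq_bigl => x.
by rewrite !inE; case: eqP => [->|]; rewrite ?ltij ?andbF.
Qed.

(* Entries below [j] only occur in the first [j] rows. *)
Lemma ssyt_content_dominated T ka : size ka <= n -> is_ssyt T ->
  content T = shape_monomial ka -> forall j, sumn (take j ka) <= sumn (take j nu).
Proof.
move=> size_ka T_ssyt T_ka j; rewrite sumn_take_nth.
have -> : \sum_(i < j) nth 0 ka i = \sum_(i < n | i < j) content T i.
  under [RHS]eq_bigr => i _ do rewrite T_ka mnmE.
  rewrite (big_ord_widen (maxn j n) (nth 0 ka)) ?leq_maxl //.
  rewrite [RHS](big_ord_widen_cond (maxn j n) (fun i => i < j) (nth 0 ka)) ?leq_maxr //.
  rewrite [RHS]big_mkcondr; apply: eq_bigr => i _; case: ltnP => // ge_n.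
  by rewrite nth_default // (leq_trans size_ka).
rewrite content_prefix -count_rows_straight -(card_seq_sub_pred _ (diagram_uniq nu [::])).
apply/subset_leq_card/subsetP => x; rewrite !inE => lt_j.
have [i [k cE]] := straight_cell (valP x); have in_D := valP x; rewrite cE in in_D *.
have := ssyt_entry_ge_row T_ssyt in_D; rewrite -{1}cE entry_val => le_row.
exact: leq_ltn_trans le_row lt_j.
Qed.

Lemma superstandard_tableau : size nu <= n ->
  exists2 T : {ffun seq_sub D -> 'I_n}, is_ssyt T & content T = shape_monomial nu.
Proof.
move=> size_nu.
have row_lt (x : seq_sub D) : (val x).1.-1 < n.
  have [i [j cE]] := straight_cell (valP x); have := valP x; rewrite cE mem_straight /=.
  move=> in_row; apply: leq_trans size_nu; rewrite -partition_nth_gt0 //.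
  exact: leq_ltn_trans in_row.
pose T := [ffun x => Ordinal (row_lt x)]; exists T.
  have entryT i j : (i, j) \in D -> entry 0 T (i, j) = i.-1.
    by move=> ij; rewrite -[(i, j)]/(val (SeqSub ij)) entry_val ffunE.
  apply/(ssytP 0); split=> [i j j' ij ij' _|i i' j ij i'j ltii']; rewrite !entryT //.
  by move: ij; rewrite mem_diagram => /andP[i_gt0 _]; rewrite ltn_predRL prednK.
apply/mnmP => i; rewrite contentE mnmE -count_row_straight.
rewrite -(card_seq_sub_pred _ (diagram_uniq nu [::])); apply: eq_card => x.
rewrite !inE ffunE -val_eqE /=.
by have [r [j ->]] := straight_cell (valP x).
Qed.

End Content.

(* For a partition of [k] this is the sum of [i * nu_i] over [i >= 1]. *)
Definition tail_weight k (nu : seq nat) := \sum_(j < k.+1) sumn (drop j nu).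

Lemma dominated_tail ka nu : dominated ka nu -> forall j, sumn (drop j nu) <= sumn (drop j ka).
Proof.
case=> sum_eq dom j; have := dom j.
by move: sum_eq; rewrite -{1}(cat_take_drop j ka) -{1}(cat_take_drop j nu) !sumn_cat; lia.
Qed.

Lemma tail_weight_lt k ka nu : is_partition ka -> is_partition nu -> sumn nu = k ->
  dominated ka nu -> nu != ka -> tail_weight k nu < tail_weight k ka.
Proof.
move=> ka_part nu_part nu_sum dom; have [sum_eq _] := dom; have tail_le := dominated_tail dom.
rewrite ltnNge; apply: contra => ge_weight.
have tail_eq j : sumn (drop j nu) = sumn (drop j ka).
  case: (leqP j k) => [lejk|ltkj].
    apply/eqP; rewrite eqn_leq tail_le leqNgt; apply: contraL ge_weight => lt_tail.
    have lt_j : j < k.+1 := lejk.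
    rewrite -ltnNge /tail_weight (bigD1 (Ordinal lt_j)) //= [X in _ < X](bigD1 (Ordinal lt_j)) //=.
    by rewrite -addSn leq_add // leq_sum.
  rewrite !drop_oversize //; apply: leq_trans (ltnW ltkj).
    by rewrite -nu_sum -sum_eq size_partition_le.
  by rewrite -nu_sum size_partition_le.
apply/eqP/eq_partition => // i.
by have := tail_eq i; rewrite (sumn_dropS nu) (sumn_dropS ka) tail_eq => /addIn.
Qed.

Local Open Scope ring_scope.

(* The monomial of shape [ka] only occurs in [schur k nu] if [nu] dominates [ka]: the
   coefficients vanish one by one from the top of the dominance order. *)
Lemma schur_independent k (d : seq nat -> int) :
  \sum_(nu <- partitions k) d nu *: schur k nu = 0 ->
  forall nu, nu \in partitions k -> d nu = 0.
Proof.
move=> sum_eq0 ka.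
have [m] := ubnP (tail_weight k ka); elim: m ka => // m IHm ka; rewrite ltnS => lem ka_in.
have [ka_part /eqP ka_sum] := andP (etrans (esym (mem_partitions k ka)) ka_in).
have ka_size : (size ka <= k)%N by rewrite -ka_sum size_partition_le.
have := congr1 (mcoeff (shape_monomial k ka)) sum_eq0; rewrite mcoeff0 raddf_sum /=.
rewrite (bigD1_seq ka) ?partitions_uniq //= big1_seq => [|nu /andP[nu_neq nu_in]]; last first.
  have := nu_in; rewrite mem_partitions => /andP[nu_part /eqP nu_sum].
  rewrite mcoeffZ mcoeff_schur.
  case: (pickP [pred T : {ffun seq_sub (diagram nu [::]) -> 'I_k} |
                 is_ssyt T & content T == shape_monomial k ka]) => [T|no_T]; last first.
    by rewrite (eq_card0 no_T) mulr0.
  case/andP=> T_ssyt /eqP T_ka; rewrite IHm ?mul0r //.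
  apply: leq_trans lem; apply: tail_weight_lt => //; split; first by rewrite ka_sum.
  exact: ssyt_content_dominated T_ka.
rewrite addr0 mcoeffZ mcoeff_schur => /eqP; rewrite mulf_eq0 => /predU1P[//|].
have [T T_ssyt T_ka] := superstandard_tableau ka_part ka_size.
by rewrite pnatr_eq0 => /eqP/card0_eq/(_ T); rewrite inE T_ssyt T_ka eqxx.
Qed.

Local Close Scope ring_scope.

(** * Shapes that admit a chain *)

Definition overlap_count (L : flagged_rows) i := count snd (drop i L).
Definition tail_size (L : flagged_rows) i := sumn (drop i (unzip1 L)).

Definition admissible (L : flagged_rows) (nu : seq nat) : Prop :=
  [/\ is_partition nu, dominated (unzip1 L) nu &
      forall i, nth 0 nu i + overlap_count L i <= tail_size L i].

Definition long_rows (L : flagged_rows) : bool :=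
  [&& sorted geq (unzip1 L), all (fun a => 2 <= a) (unzip1 L) & ~~ (last (0, false) L).2].

Lemma dominatedP al nu :
  dominated al nu <->
  sumn al = sumn nu /\ forall k, \sum_(j < k) nth 0 al j <= \sum_(j < k) nth 0 nu j.
Proof. by split=> -[sum_eq dom]; split=> // k; have := dom k; rewrite !sumn_take_nth. Qed.

Lemma tail_size0 L : tail_size L 0 = sumn (unzip1 L).
Proof. by rewrite /tail_size drop0. Qed.

Lemma tail_sizeS L i : tail_size L i = nth 0 (unzip1 L) i + tail_size L i.+1.
Proof. exact: sumn_dropS. Qed.

Lemma tail_size_oversize L i : size L <= i -> tail_size L i = 0.
Proof. by move=> ge_size; rewrite /tail_size drop_oversize ?size_map. Qed.

Lemma sum_prefix_tail_size L k :
  \sum_(j < k) nth 0 (unzip1 L) j + tail_size L k = sumn (unzip1 L).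
Proof. by rewrite -sumn_take_nth sumn_take_drop. Qed.

Lemma overlap_countS L i : overlap_count L i = (nth (0, false) L i).2 + overlap_count L i.+1.
Proof.
rewrite /overlap_count; case: (ltnP i (size L)) => [lt_size|ge_size].
  by rewrite (drop_nth (0, false)).
by rewrite nth_default // !drop_oversize // leqW.
Qed.

Lemma overlap_count_le (L : flagged_rows) i :
  ~~ (last (0, false) L).2 -> overlap_count L i <= size L - i.+1.
Proof.
case/lastP: L => // L y; rewrite last_rcons size_rcons subSS /overlap_count => /negbTE y_free.
case: (leqP i (size L)) => [le_size|gt_size]; last by rewrite drop_oversize ?size_rcons.
by rewrite drop_rcons // -cats1 count_cat /= y_free !addn0 -size_drop count_size.
Qed.

Lemma long_rows_behead a b L : long_rows ((a, b) :: L) -> long_rows L.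
Proof.
case/and3P=> /path_sorted L_sorted /andP[_ L_ge2] L_last; apply/and3P; split=> //.
by case: (L) L_last.
Qed.

Section LongRows.
Variable L : flagged_rows.
Hypothesis L_long : long_rows L.

Lemma long_rows_homo : {homo nth 0 (unzip1 L) : i j /~ i <= j}.
Proof. by case/and3P: L_long => L_sorted _ _; apply: sorted_geq_nth. Qed.

Lemma long_rows_ge2 i : i < size L -> 2 <= nth 0 (unzip1 L) i.
Proof.
by case/and3P: L_long => _ /(all_nthP 0) L_ge2 _ lt_size; apply: L_ge2; rewrite size_map.
Qed.

Lemma long_rows_tail_size i : 2 * (size L - i) <= tail_size L i.
Proof.
case/and3P: L_long => _ + _; rewrite -(size_map fst L) -size_drop /tail_size.
rewrite -{1}(cat_take_drop i (unzip1 L)) all_cat => /andP[_].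
by elim: (drop i _) => //= a s IHs /andP[a_ge2 /IHs]; lia.
Qed.

Lemma long_rows_overlap_count i : overlap_count L i <= size L - i.+1.
Proof. by case/and3P: L_long => _ _; apply: overlap_count_le. Qed.

End LongRows.

(* A chain starts by removing a horizontal strip that contains the last cell of the
   last longest row [m] of [nu]: every strip [rho / nu] with a cell below the first
   row then has a cell below row [m], hence a descent. [next_row] is the most
   dominant choice for the remaining partition that respects the bounds of
   [admissible] for the remaining rows. *)
Section FirstStrip.
Variables (L : flagged_rows) (nu : seq nat) (m : nat).
Hypotheses (L_long : long_rows L) (L_gt0 : 0 < size L) (nu_adm : admissible L nu).
Hypotheses (m_max : nth 0 nu m = nth 0 nu 0) (m_last : nth 0 nu m.+1 < nth 0 nu 0).
Notation l := (size L).
Notation alpha := (nth 0 (unzip1 L)).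
Notation tail := (tail_size L).
Notation overlaps := (overlap_count L).
Notation row := (nth 0 nu).

Let alpha_homo : {homo alpha : i j /~ i <= j} := long_rows_homo L_long.
Let tail_ge i : 2 * (l - i) <= tail i := long_rows_tail_size L_long i.
Let overlaps_le i : overlaps i <= l - i.+1 := long_rows_overlap_count L_long i.

Let row_homo : {homo row : i j /~ i <= j}.
Proof. by case: nu_adm => nu_part _ _; apply: partition_nth_homo. Qed.

Let row_le_tail i : row i + overlaps i <= tail i. Proof. by case: nu_adm. Qed.

Let row_dom k : \sum_(j < k) alpha j <= \sum_(j < k) row j.
Proof. by case: nu_adm => _ /dominatedP[_]. Qed.

Let sum_row_le k : \sum_(j < k) row j <= tail 0.
Proof.
by case: nu_adm => _ [sum_eq _] _; rewrite tail_size0 sum_eq -sumn_take_nth leq_sumn_take.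
Qed.

Let sum_row k : row k = 0 -> \sum_(j < k) row j = tail 0.
Proof.
case: nu_adm => nu_part [sum_eq _] _ rowk0; rewrite tail_size0 sum_eq sum_nth //.
by rewrite partition_size_leq ?rowk0.
Qed.

Let row_oversize i : l <= i -> row i = 0.
Proof. by move=> ge_l; have := row_le_tail i; rewrite tail_size_oversize //; lia. Qed.

Let sum_alpha k : \sum_(j < k) alpha j + tail k = tail 0.
Proof. by rewrite sum_prefix_tail_size tail_size0. Qed.

Let sum_alpha_behead k : \sum_(j < k) alpha j.+1 + tail k.+1 = tail 1.
Proof. by have := sum_alpha k.+1; rewrite sum_ord_recl (tail_sizeS L 0); lia. Qed.

Let row0_ge : alpha 0 <= row 0. Proof. by have := row_dom 1; rewrite !big_ord1. Qed.
Let row0_ge2 : 2 <= row 0. Proof. exact: leq_trans (long_rows_ge2 L_long L_gt0) row0_ge. Qed.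

Definition next_capacity j := tail j.+1 - overlaps j.+1.
Definition trimmed_row j := row j - (j == m).
Definition row_bound j := minn (trimmed_row j) (next_capacity j).
Definition clipped j : bool := next_capacity j < trimmed_row j.

Lemma next_capacityE j : next_capacity j + overlaps j.+1 = tail j.+1.
Proof. by rewrite /next_capacity; have := row_le_tail j.+1; lia. Qed.

Lemma next_capacity_ge j : j.+1 < l -> l - j <= next_capacity j.
Proof.
by have := tail_ge j.+1; have := overlaps_le j.+1; have := next_capacityE j; lia.
Qed.

Lemma rowS_le_next_capacity j : row j.+1 <= next_capacity j.
Proof. by have := next_capacityE j; have := row_le_tail j.+1; lia. Qed.

Lemma row_le_next_capacity j : row j <= alpha j + next_capacity j.
Proof.
have := row_le_tail j; have := next_capacityE j.
by rewrite (tail_sizeS L j) (overlap_countS L j); lia.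
Qed.

Lemma sum_trimmed_row k : \sum_(j < k) trimmed_row j + (m < k) = \sum_(j < k) row j.
Proof.
elim: k => [|k IHk]; first by rewrite !big_ord0.
rewrite !sum_ord_recr -IHk ltnS leq_eqVlt /trimmed_row eq_sym.
by case: (eqVneq m k) => [<-|_] /=; rewrite ?ltnn ?m_max; lia.
Qed.

Lemma trimmed_row_dom k : k < l -> \sum_(j < k) alpha j.+1 <= \sum_(j < k) trimmed_row j.
Proof.
move=> ltkl; have sum_trimmed := sum_trimmed_row k.
have dom := row_dom k; have domS := row_dom k.+1.
have sum_alphaS : \sum_(j < k) alpha j + alpha k = alpha 0 + \sum_(j < k) alpha j.+1.
  by rewrite -sum_ord_recr sum_ord_recl.
rewrite !sum_ord_recr in domS; have alphak_le := alpha_homo (leq0n k).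
case: (ltnP m k) sum_trimmed => [ltmk|_] sum_trimmed; last by lia.
rewrite leqNgt; apply/negP => sum_lt.
have alpha_const : alpha k = alpha 0 by lia.
have rowk_lt : row k < row 0 by apply: leq_ltn_trans m_last; apply: row_homo.
have sum_row_ge := leq_sum_nonincr k row_homo; rewrite sum_ord_recr in sum_row_ge.
have sum_alpha_le := geq_sum_nonincr k alpha_homo.
have : k * alpha 0 <= k * row k by apply: leq_mul => //; lia.
by lia.
Qed.

Lemma row_bound_clipped j : clipped j -> row_bound j = next_capacity j.
Proof. by move=> clipped_j; apply/minn_idPr/ltnW. Qed.

Lemma row_bound_unclipped j : ~~ clipped j -> row_bound j = trimmed_row j.
Proof. by rewrite /clipped -leqNgt => /minn_idPl. Qed.

Lemma row_bound_le j : row_bound j <= row j.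
Proof. by rewrite /row_bound /trimmed_row; lia. Qed.

Lemma row_bound_geS j : row j.+1 <= row_bound j.
Proof.
rewrite /row_bound leq_min rowS_le_next_capacity andbT /trimmed_row.
by case: eqP => [->|_] /=; have := row_homo (leqnSn j); rewrite ?m_max; lia.
Qed.

Lemma row_bound_gt0 j : j.+1 < l -> 0 < row j -> 0 < row_bound j.
Proof.
move=> lt_l rowj_gt0; have capacity_gt0 : 0 < next_capacity j.
  by have := next_capacity_ge lt_l; lia.
rewrite /row_bound leq_min capacity_gt0 andbT /trimmed_row.
by case: eqP => [->|_] /=; rewrite ?m_max; lia.
Qed.

Lemma clipped_trimmed_row_lt i :
  i.+1 < l -> clipped i -> trimmed_row i < alpha 0 + next_capacity i.
Proof.
move=> lt_l clipped_i; have alphai_le := alpha_homo (leq0n i).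
have rowi_le := row_le_next_capacity i; case: (ltngtP i m) => [ltim|ltmi|im].
- have : row m <= row i.+1 by apply: row_homo.
  have := rowS_le_next_capacity i; have := row_homo (leq0n i).
  by move: clipped_i; rewrite m_max /clipped /trimmed_row; lia.
- rewrite /trimmed_row gtn_eqF // subn0 ltnNge; apply/negP => rowi_ge.
  have rowi_lt : row i < row 0 by apply: leq_ltn_trans m_last; apply: row_homo.
  have sum_row_ge := leq_trans (leq_sum_nonincr i row_homo) (sum_row_le i.+1).
  have sum_alpha_le := geq_sum_nonincr i.+1 alpha_homo; rewrite mulSn in sum_alpha_le.
  have mul_row : i * alpha 0 + i * next_capacity i <= i * row i.
    by rewrite -mulnDr leq_mul2l rowi_ge orbT.
  have mul_capacity : next_capacity i <= i * next_capacity i by rewrite leq_pmull //; lia.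
  have := sum_alpha i.+1; have := next_capacity_ge lt_l.
  by have := next_capacityE i; have := overlaps_le i.+1; lia.
by move: alphai_le rowi_le; rewrite /trimmed_row im eqxx m_max; have := row0_ge2; lia.
Qed.

Section FirstClippedRow.
Variables i k : nat.
Hypotheses (ltik : i < k) (ltkl : k < l) (clipped_i : clipped i).
Hypothesis unclipped : forall j, j < i -> ~~ clipped j.

(* The bound of row [i] falls short of the sum of all later parts by [overlaps i.+1]
   only. *)
Lemma dom_upto_clipped_row :
  \sum_(j < k) alpha j.+1 + tail k.+1 <= \sum_(j < i.+1) row_bound j + overlaps i.+1.
Proof.
have -> : \sum_(j < i.+1) row_bound j = \sum_(j < i) trimmed_row j + next_capacity i.
  rewrite sum_ord_recr row_bound_clipped //; congr (_ + _).
  by apply: eq_bigr => j _; rewrite row_bound_unclipped ?unclipped.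
have := trimmed_row_dom (ltn_trans ltik ltkl); have := sum_alpha_behead i.
by have := sum_alpha_behead k; have := next_capacityE i; lia.
Qed.

Lemma leq_sum_row_bound x : i < x <= k -> 0 < row x.-1 ->
  \sum_(j < i.+1) row_bound j + (x - i.+1) <= \sum_(j < x) row_bound j.
Proof.
move=> /andP[ltix lexk] rowx_gt0; apply: leq_sum_positive => // j /andP[_ ltjx].
apply: row_bound_gt0; first by lia.
by apply: leq_trans rowx_gt0 _; apply: row_homo; lia.
Qed.

Lemma row_bound_dom_positive :
  0 < row k.-1 -> \sum_(j < k) alpha j.+1 <= \sum_(j < k) row_bound j.
Proof.
move=> rowk_gt0; have k_range : i < k <= k by rewrite ltik /=.
have := leq_sum_row_bound k_range rowk_gt0; have := dom_upto_clipped_row.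
by have := overlaps_le i.+1; have := tail_ge k.+1; lia.
Qed.

Lemma row_bound_dom_two_clipped i' : i < i' < k -> clipped i' ->
  \sum_(j < k) alpha j.+1 <= \sum_(j < k) row_bound j.
Proof.
move=> /andP[ltii' lti'k] clipped_i'.
have row_gt0 : 0 < row i'.-1.
  have : 0 < row i' by move: clipped_i'; rewrite /clipped /trimmed_row; lia.
  by move/leq_trans; apply; apply: row_homo; lia.
have sum_bound : \sum_(j < i.+1) row_bound j + (i' - i.+1) <= \sum_(j < i') row_bound j.
  by apply: leq_sum_row_bound => //; rewrite ltii' ltnW.
have := leq_sum_prefix row_bound lti'k; rewrite sum_ord_recr row_bound_clipped //.
have := @next_capacity_ge i' ltac:(lia).
by have := dom_upto_clipped_row; have := overlaps_le i.+1; lia.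
Qed.

Lemma row_bound_dom_one_clipped :
  row k.-1 = 0 -> (forall j, i < j < k -> ~~ clipped j) ->
  \sum_(j < k) alpha j.+1 <= \sum_(j < k) row_bound j.
Proof.
move=> row_pred0 unclipped_after.
have row0_after j : k.-1 <= j -> row j = 0.
  by move/row_homo; rewrite row_pred0; lia.
have ltmk : m < k.
  by rewrite ltnNge; apply/negP => lekm; have := row0_after m; rewrite m_max; lia.
have sum_trimmed := sum_trimmed_row k.
rewrite ltmk sum_row ?row0_after ?leq_pred // in sum_trimmed.
have sum_bound : \sum_(j < k) row_bound j + trimmed_row i =
    \sum_(j < k) trimmed_row j + next_capacity i.
  rewrite !(bigD1 (Ordinal ltik) (P := predT)) //= row_bound_clipped //.
  rewrite (eq_bigr (fun j : 'I_k => trimmed_row j)) => [|j j_neq]; first by lia.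
  apply: row_bound_unclipped; case: (ltngtP j i) => [|ltij|ij]; first exact: unclipped.
    by rewrite unclipped_after ?ltij /=.
  by case/eqP: j_neq; apply: val_inj.
have trimmed_lt := clipped_trimmed_row_lt (leq_ltn_trans ltik ltkl) clipped_i.
by have := sum_alpha_behead k; have := tail_sizeS L 0; lia.
Qed.

End FirstClippedRow.

Lemma row_bound_dom_lt k : k < l -> \sum_(j < k) alpha j.+1 <= \sum_(j < k) row_bound j.
Proof.
move=> ltkl; case: (boolP [exists i : 'I_k, clipped i]) => [/existsP[i0 clipped_i0]|].
  have ex_clipped : exists i, (i < k) && clipped i by exists i0; rewrite ltn_ord.
  case: (ex_minnP ex_clipped) => i /andP[ltik clipped_i] min_i.
  have unclipped j : j < i -> ~~ clipped j.
    by move=> ltji; apply/negP => clipped_j; have := min_i j; rewrite clipped_j; lia.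
  case: (posnP (row k.-1)) => [row_pred0|]; last exact: (row_bound_dom_positive ltik).
  case: (boolP [exists j : 'I_k, (i < j) && clipped j]) => [/existsP[j]|/existsPn no_clip].
    case/andP=> ltij; apply: (row_bound_dom_two_clipped ltik ltkl clipped_i unclipped).
    by rewrite ltij /=.
  apply: (row_bound_dom_one_clipped ltik) => // j /andP[ltij ltjk].
  by have := no_clip (Ordinal ltjk); rewrite ltij.
move/existsPn=> no_clip; apply: leq_trans (trimmed_row_dom ltkl) _.
by apply: leq_sum => j _; rewrite row_bound_unclipped.
Qed.

Lemma row_bound_dom k : \sum_(j < k) alpha j.+1 <= \sum_(j < k) row_bound j.
Proof.
case: (ltnP k l) => [|lelk]; first exact: row_bound_dom_lt.
have ltl : l.-1 < l by lia.
have := row_bound_dom_lt ltl; have := @leq_sum_prefix row_bound l.-1 k ltac:(lia).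
have := sum_alpha_behead l.-1; have := sum_alpha_behead k.
by rewrite (prednK L_gt0) (tail_size_oversize (leqnn l)) (tail_size_oversize (leqW lelk)); lia.
Qed.

Definition next_row j :=
  row j.+1 + greedy_fill (fun i => row_bound i - row i.+1) (row 0 - alpha 0) j.

Lemma next_row_le j : next_row j <= row_bound j.
Proof.
have := leq_greedy_fill (fun i => row_bound i - row i.+1) (row 0 - alpha 0) j.
by have := row_bound_geS j; rewrite /next_row; lia.
Qed.

Lemma sum_next_row k : \sum_(j < k) next_row j + row 0 =
  minn (\sum_(j < k) row_bound j + row 0) (\sum_(j < k.+1) row j + (row 0 - alpha 0)).
Proof.
have sum_bound : \sum_(j < k) row_bound j =
    \sum_(j < k) row j.+1 + \sum_(j < k) (row_bound j - row j.+1).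
  by rewrite -big_split /=; apply: eq_bigr => j _; have := row_bound_geS j; lia.
have sum_next : \sum_(j < k) next_row j =
    \sum_(j < k) row j.+1 + minn (row 0 - alpha 0) (\sum_(j < k) (row_bound j - row j.+1)).
  by rewrite -(sum_greedy_fill (fun j => row_bound j - row j.+1)) -big_split.
by rewrite sum_next sum_bound (sum_ord_recl row); lia.
Qed.

Lemma next_row_dom k : \sum_(j < k) alpha j.+1 <= \sum_(j < k) next_row j.
Proof.
have := sum_next_row k; have := row_bound_dom k; have := row_dom k.+1.
by rewrite (sum_ord_recl alpha); lia.
Qed.

Lemma sum_next_row_all : \sum_(j < l) next_row j = tail 1.
Proof.
have := sum_next_row l; have := next_row_dom l; have := sum_alpha_behead l.
rewrite (sum_row (row_oversize (leqnSn l))) (tail_size_oversize (leqnSn l)).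
by rewrite (tail_sizeS L 0); lia.
Qed.

(* Otherwise [nu] has a single row, or row [0] of [next_row] attains its bound; both
   leave no room for the first overlap. *)
Lemma next_row_lt_below_first :
  (nth (0, false) L 0).2 -> exists2 j, 0 < j & next_row j < row j.
Proof.
move=> flag0; case: (boolP [exists j : 'I_l, (0 < j) && (next_row j < row j)]).
  by case/existsP=> j /andP[]; exists j.
move/existsPn=> no_lt; exfalso.
have overlaps0 := overlap_countS L 0; rewrite flag0 in overlaps0.
have alpha0_ge2 := long_rows_ge2 L_long L_gt0.
have row0_le := row_le_tail 0; have tail0 := tail_sizeS L 0.
have next_eq j : 0 < j < l -> next_row j = row j.
  move=> /andP[j_gt0 ltjl]; have := no_lt (Ordinal ltjl); have := next_row_le j.
  by have := row_bound_le j; rewrite /= j_gt0; lia.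
have next0 : next_row 0 + alpha 0 = row 0.
  have later_eq : \sum_(j < l.-1) next_row j.+1 = \sum_(j < l.-1) row j.+1.
    by apply: eq_bigr => j _; apply: next_eq; have := ltn_ord j; lia.
  have := sum_next_row_all; have := sum_row (row_oversize (leqnn l)).
  by rewrite -(prednK L_gt0) !sum_ord_recl later_eq; lia.
have row1_gt0 : 0 < row 1.
  by rewrite lt0n; apply/eqP => /sum_row; rewrite sum_ord_recr big_ord0; lia.
have := sum_next_row 1; rewrite !sum_ord_recr !big_ord0 !add0n.
by have := next_capacityE 0; rewrite /row_bound /trimmed_row; lia.
Qed.

Definition next_partition := partition_of next_row l.

Let next_row_dec i : next_row i.+1 <= next_row i.
Proof.
apply: leq_trans (next_row_le _) _; apply: leq_trans (row_bound_le _) _.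
exact: leq_addr.
Qed.

Let next_row_vanish : next_row l = 0.
Proof. by have := next_row_le l; have := row_bound_le l; rewrite row_oversize //; lia. Qed.

Lemma nth_next_partition i : nth 0 next_partition i = next_row i.
Proof. exact: nth_partition_of next_row_dec next_row_vanish i. Qed.

Lemma next_partition_hstrip : hstrip nu next_partition.
Proof.
apply/hstripP => i; rewrite nth_next_partition (leq_trans (next_row_le i)) ?row_bound_le //.
by rewrite andbT leq_addr.
Qed.

Lemma next_partition_admissible : admissible (behead L) next_partition.
Proof.
have alpha_behead : unzip1 (behead L) = drop 1 (unzip1 L) by rewrite drop1 /unzip1 behead_map.
split; first exact: is_partition_of next_row_dec.
  apply/dominatedP; rewrite alpha_behead; split=> [|k].
    by rewrite (sumn_partition_of next_row_dec next_row_vanish) sum_next_row_all.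
  under eq_bigr => j _ do rewrite nth_drop add1n.
  by under [X in _ <= X]eq_bigr => j _ do rewrite nth_next_partition; apply: next_row_dom.
move=> i; rewrite nth_next_partition /overlap_count /tail_size alpha_behead -drop1.
rewrite !drop_drop addn1 -/(overlaps i.+1) -/(tail i.+1) -next_capacityE leq_add2r.
exact: leq_trans (next_row_le i) (geq_minr _ _).
Qed.

Lemma next_partition_lt_max : nth 0 next_partition m < nth 0 nu m.
Proof.
rewrite nth_next_partition; apply: leq_ltn_trans (next_row_le m) _.
by rewrite /row_bound /trimmed_row eqxx m_max; have := row0_ge2; lia.
Qed.

End FirstStrip.

Lemma last_longest_row nu : is_partition nu -> 0 < nth 0 nu 0 ->
  exists2 m, nth 0 nu m = nth 0 nu 0 & nth 0 nu m.+1 < nth 0 nu 0.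
Proof.
move=> nu_part nu_gt0.
have ex_shorter : exists k, nth 0 nu k < nth 0 nu 0 by exists (size nu); rewrite nth_default.
case: (ex_minnP ex_shorter) => -[|m]; first by rewrite ltnn.
move=> shorter min_m; exists m => //; apply/eqP; rewrite eqn_leq partition_nth_homo //= leqNgt.
by apply/negP => /min_m; rewrite ltnn.
Qed.

Lemma strip_first_row nu ka a : hstrip nu ka -> sumn nu = sumn ka + a ->
  nth 0 nu 0 <= nth 0 ka 0 + a.
Proof.
move=> strip nu_sum; have := sumn_dropS nu 0; have := sumn_dropS ka 0; rewrite !drop0.
have : sumn (drop 1 ka) <= sumn (drop 1 nu).
  by apply: leq_sumn => i; rewrite !nth_drop hstrip_nth_le.
lia.
Qed.

Lemma strip_first_row_lt nu ka a j : hstrip nu ka -> sumn nu = sumn ka + a ->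
  0 < j -> nth 0 ka j < nth 0 nu j -> nth 0 nu 0 < nth 0 ka 0 + a.
Proof.
move=> strip nu_sum j_gt0 lt_j.
have := sumn_dropS nu 0; have := sumn_dropS ka 0; rewrite !drop0.
have : sumn (drop 1 ka) < sumn (drop 1 nu).
  apply: (@ltn_sumn _ _ j.-1) => [i|]; rewrite !nth_drop ?add1n ?prednK //.
  exact: hstrip_nth_le.
lia.
Qed.

Lemma strip_dominated nu ka al a : hstrip nu ka -> sumn nu = sumn ka + a ->
  dominated al ka -> dominated (a :: al) nu.
Proof.
move=> strip nu_sum [sum_eq dom]; split=> [|[|k]] //=; first by rewrite sum_eq nu_sum addnC.
have tail_le : sumn (drop k.+1 nu) <= sumn (drop k ka).
  by apply: leq_sumn => i; rewrite !nth_drop hstrip_nthS_le.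
by have := dom k; have := sumn_take_drop nu k.+1; have := sumn_take_drop ka k; lia.
Qed.

Lemma admissible_cons a (b : bool) L nu ka :
  hstrip nu ka -> is_partition nu -> sumn nu = sumn ka + a ->
  (b -> nth 0 nu 0 < nth 0 ka 0 + a) -> admissible L ka -> admissible ((a, b) :: L) nu.
Proof.
move=> strip nu_part nu_sum first_lt [ka_part dom bound].
split=> //; first exact: strip_dominated dom.
case=> [|i].
  have := strip_first_row strip nu_sum; have := bound 0.
  rewrite (tail_sizeS (_ :: L) 0) (overlap_countS (_ :: L) 0) /tail_size /overlap_count /= !drop0.
  by case: b first_lt => [/(_ isT)|_]; lia.
have := bound i; rewrite /overlap_count /tail_size /=.
by have := hstrip_nthS_le i strip; lia.
Qed.

Lemma chain_count_gt0_admissible L b rho nu :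
  ~~ (last (0, false) L).2 -> is_partition nu -> 0 < chain_count L b rho nu ->
  admissible L nu /\ (b -> L != [::] -> exists2 j, 0 < j & nth 0 nu j < nth 0 rho j).
Proof.
elim: L b rho nu => [|[a b'] L IHL] b rho nu L_last nu_part /=.
  by rewrite lt0b => /eqP ->; split=> //; split=> // i; rewrite nth_nil.
rewrite lt0n sum_nat_seq_neq0 => /hasP[ka /strip_removalsP[ka_part nu_sum strip]].
rewrite -lt0n => /andP[desc chain_gt0].
have ka_last : ~~ (last (0, false) L).2 by case: (L) L_last.
have [ka_adm overlap_lt] := IHL b' nu ka ka_last ka_part chain_gt0; split.
  apply: admissible_cons ka_adm => // b'T; case: overlap_lt => // [|j j_gt0 lt_j].
    by apply/eqP => L0; rewrite L0 b'T in L_last.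
  exact: strip_first_row_lt lt_j.
by move=> bT _; move: desc; rewrite bT /= => /descentP[i [j [ltij _ lt_j]]]; exists j; lia.
Qed.

Lemma admissible_nil nu : admissible [::] nu -> nu = [::].
Proof. by case=> nu_part [sum_eq _] _; apply/eqP; rewrite -partition_sumn0 // -sum_eq. Qed.

Lemma descent_last_longest_row ka nu rho m j :
  is_partition nu -> hstrip rho nu -> nth 0 nu m = nth 0 nu 0 -> nth 0 ka m < nth 0 nu m ->
  0 < j -> nth 0 nu j < nth 0 rho j -> descent ka nu rho.
Proof.
move=> nu_part strip m_max ltm j_gt0 ltj; apply/descentP; exists m, j; split=> //.
have nu_homo := partition_nth_homo nu_part; rewrite ltnNge; apply/negP => /nu_homo nu_le.
by have := hstrip_nthS_le j.-1 strip; have := nu_homo _ _ (leq0n j.-1); rewrite prednK //; lia.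
Qed.

Lemma admissible_chain_count_gt0 (L : flagged_rows) (b : bool) rho nu :
  long_rows L -> admissible L nu ->
  (b -> [/\ L != [::], hstrip rho nu & exists2 j, 0 < j & nth 0 nu j < nth 0 rho j]) ->
  0 < chain_count L b rho nu.
Proof.
elim: L b rho nu => [|[a b'] L IHL] b rho nu L_long nu_adm start.
  by rewrite (admissible_nil nu_adm).
have [nu_part dom _] := nu_adm; have [/= al_sorted /andP[a_ge2 _] L_last] := and3P L_long.
have [m m_max m_last] : exists2 m, nth 0 nu m = nth 0 nu 0 & nth 0 nu m.+1 < nth 0 nu 0.
  apply: last_longest_row => //; case/dominatedP: dom => _ /(_ 1); rewrite !big_ord1.
  exact: leq_trans (ltnW a_ge2).
pose ka := next_partition ((a, b') :: L) nu m.
have strip : hstrip nu ka := next_partition_hstrip L_long isT nu_adm m_max m_last.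
have ka_adm : admissible L ka := next_partition_admissible L_long isT nu_adm m_max m_last.
have ka_lt : nth 0 ka m < nth 0 nu m := next_partition_lt_max L_long isT nu_adm m_max m_last.
have [ka_part [ka_sum _] _] := ka_adm.
have ka_in : ka \in strip_removals a nu.
  by apply/strip_removalsP; split=> //; case: dom => <- _; rewrite -ka_sum addnC.
rewrite /= lt0n sum_nat_seq_neq0; apply/hasP; exists ka => //=.
rewrite -lt0n; apply/andP; split.
  apply/implyP => /start[_ rho_strip [j j_gt0 ltj]].
  exact: descent_last_longest_row nu_part rho_strip m_max ka_lt j_gt0 ltj.
apply: IHL => //; first exact: long_rows_behead L_long.
move=> b'T; split=> //; first by apply/eqP => L0; rewrite L0 b'T in L_last.
have [j j_gt0 ltj] := next_row_lt_below_first L_long isT nu_adm m_max m_last b'T.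
by exists j => //; rewrite (nth_next_partition L_long isT nu_adm m_max m_last).
Qed.

Lemma chain_count_gt0 L nu : long_rows L -> is_partition nu ->
  0 < chain_count L false [::] nu <-> admissible L nu.
Proof.
move=> L_long nu_part; split=> [chain_gt0|nu_adm]; last exact: admissible_chain_count_gt0.
have [_ _ L_last] := and3P L_long.
by have [] := chain_count_gt0_admissible L_last nu_part chain_gt0.
Qed.

(** * Rows that violate the bounds *)

(* The least length of row [i] that violates its bound in [admissible]. *)
Definition excess_length (L : flagged_rows) i := (tail_size L i).+1 - overlap_count L i.

Definition excess_condition (L : flagged_rows) : Prop :=
  forall i, 0 < i -> 0 < overlap_count L i ->
    overlap_count L i <= \sum_(j < i) (excess_length L i - nth 0 (unzip1 L) j).

Section Violation.
Variable L : flagged_rows.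
Hypothesis L_long : long_rows L.
Notation l := (size L).
Notation alpha := (nth 0 (unzip1 L)).
Notation tail := (tail_size L).
Notation overlaps := (overlap_count L).
Notation excess := (excess_length L).

Let alpha_homo : {homo alpha : i j /~ i <= j} := long_rows_homo L_long.
Let tail_ge i : 2 * (l - i) <= tail i := long_rows_tail_size L_long i.
Let overlaps_le i : overlaps i <= l - i.+1 := long_rows_overlap_count L_long i.

Lemma overlap_count_le_sum : overlaps 0 <= sumn (unzip1 L).
Proof. by have := overlaps_le 0; have := tail_ge 0; rewrite tail_size0; lia. Qed.

Lemma excess_lengthE i : excess i + overlaps i = (tail i).+1.
Proof. by have := tail_ge i; have := overlaps_le i; rewrite /excess_length; lia. Qed.

Lemma excess_length_ge i : i < l -> l - i < excess i.
Proof. by have := excess_lengthE i; have := tail_ge i; have := overlaps_le i; lia. Qed.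

Lemma dominated_sum_maxn nu i r : is_partition nu -> dominated (unzip1 L) nu -> r <= nth 0 nu i ->
  \sum_(j < i) maxn (alpha j) r <= \sum_(j < i) nth 0 nu j.
Proof.
move=> nu_part /dominatedP[_ dom] le_r.
suff le_k k : k <= i -> \sum_(j < k) maxn (alpha j) r <= \sum_(j < k) nth 0 nu j by apply: le_k.
elim: k => [|k IHk] ltki; first by rewrite !big_ord0.
case: (leqP r (alpha k)) => [le_alpha|gt_alpha].
  rewrite (eq_bigr (fun j : 'I_k.+1 => alpha j)) => [|j _]; first exact: dom.
  by apply/maxn_idPl/(leq_trans le_alpha)/alpha_homo; rewrite -ltnS.
rewrite (sum_ord_recr (fun j => maxn (alpha j) r)) sum_ord_recr.
apply: leq_add; first exact/IHk/ltnW.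
rewrite (maxn_idPr (ltnW gt_alpha)) (leq_trans le_r) //.
by apply: partition_nth_homo => //; apply: ltnW.
Qed.

Lemma dominated_row_le nu i : is_partition nu -> dominated (unzip1 L) nu ->
  overlaps i <= \sum_(j < i) (excess i - alpha j) ->
  nth 0 nu i + overlaps i <= tail i.
Proof.
move=> nu_part dom le_sum; rewrite leqNgt; apply/negP => row_gt.
have sum_le : \sum_(j < i.+1) nth 0 nu j <= sumn (unzip1 L).
  by case: dom => -> _; rewrite -sumn_take_nth leq_sumn_take.
have excessE := excess_lengthE i; have le_row : excess i <= nth 0 nu i by lia.
have := dominated_sum_maxn nu_part dom le_row; rewrite sum_maxn.
by have := sum_prefix_tail_size L i; rewrite sum_ord_recr in sum_le; lia.
Qed.

Section ViolatingPartition.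
Variable i : nat.
Let padding := \sum_(j < i) (excess i - alpha j).
Hypotheses (i_range : 0 < i < l) (padding_lt : padding < overlaps i).

Let i_gt0 : 0 < i. Proof. by case/andP: i_range. Qed.

(* All rows above [i] are lengthened to [excess i], the length of row [i]; the cells
   still missing go to row [0]. *)
Definition violating_row j :=
  if j < i then maxn (alpha j) (excess i) + (j == 0) * (overlaps i - padding).-1
  else (j == i) * excess i.
Definition violating_partition := partition_of violating_row i.+1.

Let row_dec j : violating_row j.+1 <= violating_row j.
Proof.
rewrite /violating_row mul0n addn0; have := alpha_homo (leqnSn j).
case: (ltnP j.+1 i) => [ltj1i|leij1].
  by rewrite (ltnW ltj1i); lia.
by case: eqP => [<-|_] _; rewrite ?ltnSn ?mul1n ?mul0n //; lia.
Qed.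

Let row_vanish : violating_row i.+1 = 0.
Proof. by rewrite /violating_row ltnNge leqnSn /= gtn_eqF. Qed.

Let row_i : violating_row i = excess i.
Proof. by rewrite /violating_row ltnn eqxx mul1n. Qed.

Lemma sum_violating_row k : 0 < k <= i ->
  \sum_(j < k) violating_row j =
  \sum_(j < k) maxn (alpha j) (excess i) + (overlaps i - padding).-1.
Proof.
case: k => // k /= ltki.
rewrite sum_ord_recl (sum_ord_recl (fun j => maxn (alpha j) (excess i))).
rewrite (eq_bigr (fun j : 'I_k => maxn (alpha j.+1) (excess i))) => [|j _].
  by rewrite {1}/violating_row i_gt0 mul1n addnAC.
by rewrite /violating_row (leq_trans _ ltki) ?ltnS // mul0n addn0.
Qed.

Lemma nth_violating_partition j : nth 0 violating_partition j = violating_row j.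
Proof. exact: nth_partition_of row_dec row_vanish j. Qed.

Lemma is_partition_violating : is_partition violating_partition.
Proof. exact: is_partition_of row_dec. Qed.

Lemma sumn_violating_partition : sumn violating_partition = sumn (unzip1 L).
Proof.
rewrite (sumn_partition_of row_dec row_vanish) sum_ord_recr row_i.
rewrite sum_violating_row ?i_gt0 /= // sum_maxn -/padding.
by have := sum_prefix_tail_size L i; have := excess_lengthE i; lia.
Qed.

Lemma violating_partition_dominates : dominated (unzip1 L) violating_partition.
Proof.
split=> [|k]; first by rewrite sumn_violating_partition.
case: (ltnP i k) => [ltik|leki].
  rewrite (take_oversize (s := violating_partition)) ?sumn_violating_partition ?leq_sumn_take //.
  exact: leq_trans (size_partition_of _ _) ltik.
case: (posnP k) => [->|k_gt0]; first by rewrite !take0.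
rewrite !sumn_take_nth; under [X in _ <= X]eq_bigr => j _ do rewrite nth_violating_partition.
rewrite sum_violating_row ?k_gt0 //; apply: leq_trans (leq_addr _ _).
by apply: leq_sum => j _; apply: leq_maxl.
Qed.

Lemma violating_partition_first_row :
  nth 0 violating_partition 0 + overlaps 0 <= sumn (unzip1 L).
Proof.
rewrite -sumn_violating_partition (sumn_partition_of row_dec row_vanish).
apply: leq_trans (leq_sum_nonincr i (nonincr_homo row_dec)).
rewrite nth_violating_partition leq_add2l row_i.
case/andP: i_range => _ ltil; apply: leq_trans (overlaps_le 0) _.
have : i + (l - i) <= i * excess i; last by lia.
apply: leq_trans (leq_mul (leqnn i) (excess_length_ge ltil)).
by rewrite mulnS leq_add2l leq_pmull.
Qed.

Lemma violating_partition_not_admissible : ~ admissible L violating_partition.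
Proof.
case=> _ _ /(_ i); rewrite nth_violating_partition row_i.
by have := excess_lengthE i; lia.
Qed.

End ViolatingPartition.

Lemma first_row_bound_admissible :
  (forall nu, is_partition nu -> dominated (unzip1 L) nu ->
     nth 0 nu 0 + overlaps 0 <= sumn (unzip1 L) -> admissible L nu) <->
  excess_condition L.
Proof.
split=> [adm i i_gt0 overlaps_gt0|le_sum nu nu_part dom first_le].
  rewrite leqNgt; apply/negP => sum_lt.
  have i_range : 0 < i < l by have := overlaps_le i; lia.
  apply: (violating_partition_not_admissible i_range sum_lt); apply: adm.
  - exact: is_partition_violating.
  - exact: violating_partition_dominates.
  - exact: violating_partition_first_row.
split=> // -[|i]; first by rewrite tail_size0.
case: (posnP (overlaps i.+1)) => [overlaps0|overlaps_gt0]; last exact/dominated_row_le/le_sum.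
by apply: dominated_row_le; rewrite ?overlaps0.
Qed.

End Violation.

(** * The support of a ribbon *)

Lemma schur_expansion_unique lam mu c c' :
  is_schur_expansion lam mu c -> is_schur_expansion lam mu c' -> c =1 c'.
Proof.
move=> [expand c0] [expand' c'0] nu.
case: (boolP (nu \in partitions (size (diagram lam mu)))) => [nu_in|nu_out]; last first.
  by rewrite c0 ?c'0.
apply/eqP; rewrite -subr_eq0; apply/eqP.
apply: (@schur_independent _ (fun ka => c ka - c' ka)%R) nu_in.
under eq_bigr => ka _ do rewrite scalerBl.
by rewrite sumrB -expand -expand' subrr.
Qed.

Section Support.
Variables alpha lam mu : seq nat.
Hypotheses (alpha_part : is_partition alpha) (alpha_ge2 : all (fun a => 2 <= a) alpha).
Hypothesis ribbon : is_ribbon alpha lam mu.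
Notation L := (ribbon_rows lam mu).

Definition ribbon_coefficient (nu : seq nat) : int :=
  if nu \in partitions (size (diagram lam mu)) then Posz (chain_count L false [::] nu) else 0%R.

Lemma size_ribbon : size (diagram lam mu) = sumn (unzip1 L).
Proof. by rewrite (unzip1_ribbon_rows ribbon) size_diagram; have [_ _ <- _ _] := ribbon. Qed.

Lemma long_ribbon_rows : long_rows L.
Proof.
rewrite /long_rows (unzip1_ribbon_rows ribbon) alpha_ge2 last_ribbon_rows !andbT.
by case/andP: alpha_part.
Qed.

Lemma ribbon_expansion : is_schur_expansion lam mu ribbon_coefficient.
Proof.
split=> [n|nu /negbTE nu_out]; last by rewrite /ribbon_coefficient nu_out.
have [_ L_ge2 L_last] := and3P long_ribbon_rows.
rewrite (ribbon_schurE ribbon alpha_ge2) ribbon_sum_expansion //; last first.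
  by apply: sub_all L_ge2 => a; apply: ltnW.
rewrite /chain_expansion -size_ribbon; apply: eq_big_seq => nu nu_in; have := nu_in.
rewrite mem_partitions => /andP[nu_part _].
by rewrite schurE // /ribbon_coefficient nu_in -natz scaler_nat mulr_natl.
Qed.

Lemma ribbon_support nu : in_schur_support lam mu nu <-> admissible L nu.
Proof.
have coef_gt0 : (0 < ribbon_coefficient nu)%R <-> admissible L nu.
  rewrite /ribbon_coefficient mem_partitions size_ribbon.
  case: (boolP (is_partition nu && _)) => [/andP[nu_part _]|not_part].
    by rewrite ltz_nat; apply: chain_count_gt0; first exact: long_ribbon_rows.
  by split=> // -[nu_part [sum_eq _] _]; rewrite nu_part sum_eq eqxx in not_part.
rewrite -coef_gt0; split=> [[c [expand c_gt0]]|]; last first.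
  by exists ribbon_coefficient; split=> //; apply: ribbon_expansion.
by rewrite (schur_expansion_unique ribbon_expansion expand).
Qed.

End Support.

Lemma in_two_row_interval alpha q nu : q <= sumn alpha ->
  in_dominance_interval alpha [:: sumn alpha - q; q] nu <->
  [/\ is_partition nu, dominated alpha nu & nth 0 nu 0 + q <= sumn alpha].
Proof.
move=> le_q; split=> [[nu_part dom [_ /(_ 1)]]|[nu_part dom first_le]].
  by rewrite (sumn_takeS nu 0) /= take0; split=> //; lia.
have [sum_eq _] := dom; split=> //; split=> [|[|[|k]]]; rewrite ?take0 //=.
- by rewrite addn0 subnK.
- by rewrite (sumn_takeS nu 0) take0 /=; lia.
- by rewrite addn0 subnK // sum_eq leq_sumn_take.
Qed.

Lemma lt_num_nonzero s i :
  {homo nth 0 s : i j /~ i <= j} -> (i < num_nonzero s) = (0 < nth 0 s i).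
Proof.
move=> s_homo; rewrite /num_nonzero -{1}(mkseq_nth 0 s) count_map.
set N := count _ _; have N_le : N <= size s by rewrite -[X in _ <= X](size_iota 0) count_size.
case: (ltnP i (size s)) => [lt_size|ge_size]; last first.
  by rewrite nth_default // ltnNge (leq_trans N_le).
rewrite [RHS](@count_initial_segment (fun k => 0 < nth 0 s k) (size s)) // => j k /andP[ltjk _].
by move/leq_trans; apply; apply/s_homo/ltnW.
Qed.

Lemma sum_part_tail s i : i <= size s ->
  (\sum_(i.+1 <= q < (size s).+1) (part s q)%:Z = (sumn (drop i s))%:Z)%R.
Proof.
move=> le_size; rewrite big_add1 /= -(big_morph Posz PoszD (erefl _)); congr Posz.
rewrite sumnE [RHS](big_nth 0) size_drop -{1}[i]add0n big_addn.
by apply: eq_bigr => j _; rewrite nth_drop addnC.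
Qed.

Lemma pos_part_subz (a b : nat) : pos_part (a%:Z - b%:Z)%R = Posz (a - b).
Proof. by rewrite /pos_part; case: leP; lia. Qed.

Section Condition.
Variables (L : flagged_rows) (p : seq nat).
Hypotheses (L_long : long_rows L) (pE : nth 0 p =1 overlap_count L).
Notation alpha := (unzip1 L).

Lemma varrhoE i : i <= size alpha -> varrho alpha p i = Posz (excess_length L i).
Proof.
move=> le_size; rewrite /varrho sum_part_tail // /part /= pE.
by have := excess_lengthE L_long i; rewrite /tail_size; lia.
Qed.

Lemma varrho_ineqE i : i <= size alpha ->
  ((part p i.+1)%:Z <= \sum_(1 <= j < i.+1) pos_part (varrho alpha p i - (part alpha j)%:Z))%R =
  (overlap_count L i <= \sum_(j < i) (excess_length L i - nth 0 alpha j)).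
Proof.
move=> le_size; rewrite big_add1 /= big_mkord varrhoE //.
under [X in (_ <= X)%R]eq_bigr => j _ do rewrite pos_part_subz.
by rewrite -(big_morph Posz PoszD (erefl _)) /part /= pE lez_nat.
Qed.

Lemma varrho_conditionE :
  (num_nonzero p < 2 \/
   2 <= num_nonzero p /\
   forall i, 1 <= i <= num_nonzero p - 1 ->
     ((part p i.+1)%:Z <= \sum_(1 <= j < i.+1) pos_part (varrho alpha p i - (part alpha j)%:Z))%R)
  <-> excess_condition L.
Proof.
have [_ _ L_last] := and3P L_long.
have p_homo : {homo nth 0 p : i j /~ i <= j}.
  by apply: nonincr_homo => i; rewrite !pE (overlap_countS L i) leq_addl.
have size_le i : 0 < overlap_count L i -> i <= size alpha.
  by have := overlap_count_le i L_last; rewrite size_map; lia.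
have lt_num i : (i < num_nonzero p) = (0 < overlap_count L i) by rewrite lt_num_nonzero // pE.
split=> [[small i i_gt0|[_ ineq] i i_gt0 overlaps_gt0]|cond].
- by rewrite -lt_num; lia.
- by rewrite -varrho_ineqE ?size_le //; apply: ineq; have := lt_num i; lia.
case: (ltnP (num_nonzero p) 2) => [|num_ge2]; [by left | right; split=> // i i_range].
have overlaps_gt0 : 0 < overlap_count L i by rewrite -lt_num; lia.
by rewrite varrho_ineqE ?size_le // cond //; lia.
Qed.

End Condition.

Theorem theorem1p7 (alpha p lam mu : seq nat)
  (alpha_part : is_partition alpha)
  (alpha_ge2 : all (fun a => 2 <= a) alpha)
  (ribbon_alpha : is_ribbon alpha lam mu)
  (p_overlap : p = overlapping_partition lam mu) :
  (forall nu : seq nat,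
     in_schur_support lam mu nu <->
     in_dominance_interval alpha [:: sumn alpha - part p 1; part p 1] nu)
  <->
  (num_nonzero p < 2 \/
   (2 <= num_nonzero p /\
    forall i : nat, 1 <= i <= num_nonzero p - 1 ->
      ((part p i.+1)%:Z <=
       \sum_(1 <= j < i.+1) pos_part (varrho alpha p i - (part alpha j)%:Z))%R)).
Proof.
set L := ribbon_rows lam mu.
have L_long : long_rows L := long_ribbon_rows alpha_part alpha_ge2 ribbon_alpha.
have alphaE : unzip1 L = alpha := unzip1_ribbon_rows ribbon_alpha.
have pE : nth 0 p =1 overlap_count L.
  by move=> i; rewrite p_overlap (nth_overlapping_partition ribbon_alpha).
have supp nu := ribbon_support alpha_part alpha_ge2 ribbon_alpha nu.
have interval nu : in_dominance_interval alpha [:: sumn alpha - part p 1; part p 1] nu <->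
    [/\ is_partition nu, dominated alpha nu & nth 0 nu 0 + overlap_count L 0 <= sumn alpha].
  by rewrite /part pE; apply: in_two_row_interval; rewrite -alphaE overlap_count_le_sum.
rewrite -alphaE in interval *; rewrite varrho_conditionE // -first_row_bound_admissible //.
split=> [full nu nu_part dom first_le|full nu]; first by apply/supp/full/interval.
rewrite supp interval; split=> [[nu_part dom bound]|[]]; last exact: full.
by split=> //; have := bound 0; rewrite /tail_size drop0.
Qed.
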